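(* Every coCartesian fibration of simplicial sets is proper, and every Cartesian fibration of simplicial sets is smooth, with respect to the elementary homotopical datum $(\Delta^1,\emptyset)$ on simplicial sets.
   Context: Cartesian fibrations: let $p\colon X\to A$ be an inner fibration of simplicial sets (right lifting property against $\Lambda^n_k\to\Delta^n$, $0<k<n$). An edge $f\colon\Delta^1\to X$ is $p$-Cartesian if for all $n\ge2$ every lifting problem of $\Lambda^n_n\to\Delta^n$ against $p$ in which $\Delta^{\{n-1,n\}}\to\Lambda^n_n\to X$ equals $f$ has a solution. $p$ is a Cartesian fibration if it is an inner fibration and every lifting problem of $\Delta^{\{1\}}\to\Delta^1$ against $p$ has a solution that is a $p$-Cartesian edge. $p$ is a coCartesian fibration if $p^{op}$ is a Cartesian fibration. Smooth and proper for the datum $(\Delta^1,\emptyset)$: A right (left) fibration is a map with the right lifting property against $\Lambda^n_k\to\Delta^n$, $n\ge1$, with $0<k\le n$ (resp. $0\le k<n$). For a simplicial set $A$, the Contravariant (resp. Covariant) model structure on $\mathbf{sSet}/A$ associated with $(\Delta^1,\emptyset)$ is the unique one with cofibrations the monomorphisms and fibrant objects the right (resp. left) fibrations with target $A$. A map $f\colon X\to Y$ of simplicial sets is final (resp. initial) if for every simplicial set $A$ and every map $Y\to A$, $f$ is a weak equivalence over $A$ in the Contravariant (resp. Covariant) model structure on $\mathbf{sSet}/A$. A map $p\colon X\to Y$ is proper (resp. smooth) if for every diagram $$\begin{array}{ccccc}A'&\xrightarrow{w}&B'&\to&X\\ \downarrow&&\downarrow&&\downarrow p\\ A&\xrightarrow{v}&B&\to&Y\end{array}$$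 with both squares cartesian, $w$ is final (resp. initial) whenever $v$ is final (resp. initial). *)

(* Defs.v *)
From mathcomp Require Import all_boot.
From mathcomp Require Import boolp.

Set Implicit Arguments.
Unset Strict Implicit.
Unset Printing Implicit Defensive.
#[local] Obligation Tactic := idtac.

Record category := Category {
  obj :> Type;
  hom : obj -> obj -> Type;
  idm : forall X, hom X X;
  comp : forall X Y Z, hom Y Z -> hom X Y -> hom X Z;
  comp_idl : forall X Y (f : hom X Y), comp (idm Y) f = f;
  comp_idr : forall X Y (f : hom X Y), comp f (idm X) = f;
  comp_assoc : forall W X Y Z (h : hom Y Z) (g : hom X Y) (f : hom W X),
    comp h (comp g f) = comp (comp h g) f
}.
Arguments hom {c} _ _.
Arguments idm {c} X.
Arguments comp {c X Y Z} _ _.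

Declare Scope cat_scope.
Delimit Scope cat_scope with cat.
Notation "X ~> Y" := (hom X Y) (at level 90, right associativity) : cat_scope.
Notation "g ∘ f" := (comp g f) (at level 40, left associativity) : cat_scope.
Local Open Scope cat_scope.

Section CategoryNotions.
Variable C : category.

Definition is_mono (X Y : C) (f : X ~> Y) : Prop :=
  forall (Z : C) (g h : Z ~> X), f ∘ g = f ∘ h -> g = h.

Definition is_terminal (T : C) : Prop :=
  forall X : C, exists f : X ~> T, forall g : X ~> T, g = f.

(** [is_pullback f' g' g f] says that the square
      P --f'--> X
      |g'       |g
      Z --f---> Y
    is cartesian. *)
Definition is_pullback (P X Y Z : C)
    (f' : P ~> X) (g' : P ~> Z) (g : X ~> Y) (f : Z ~> Y) : Prop :=
  g ∘ f' = f ∘ g' /\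
  forall (Q : C) (a : Q ~> X) (b : Q ~> Z), g ∘ a = f ∘ b ->
    exists h : Q ~> P, [/\ f' ∘ h = a, g' ∘ h = b &
      forall k : Q ~> P, f' ∘ k = a -> g' ∘ k = b -> k = h].

Definition is_lift (A B X Y : C) (i : A ~> B) (p : X ~> Y)
    (u : A ~> X) (v : B ~> Y) (h : B ~> X) : Prop :=
  h ∘ i = u /\ p ∘ h = v.

Definition has_lifting (A B X Y : C) (i : A ~> B) (p : X ~> Y) : Prop :=
  forall (u : A ~> X) (v : B ~> Y), p ∘ u = v ∘ i ->
    exists h : B ~> X, is_lift i p u v h.

Definition is_retract (A B X Y : C) (f : A ~> B) (g : X ~> Y) : Prop :=
  exists (s : A ~> X) (r : X ~> A) (s' : B ~> Y) (r' : Y ~> B),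
    [/\ r ∘ s = idm A, r' ∘ s' = idm B, g ∘ s = s' ∘ f & f ∘ r = r' ∘ g].

Definition mor_class := forall X Y : C, X ~> Y -> Prop.

Definition retract_closed (K : mor_class) : Prop :=
  forall (A B X Y : C) (f : A ~> B) (g : X ~> Y),
    is_retract f g -> K X Y g -> K A B f.

Record model_structure := ModelStructure {
  weq : mor_class;
  cof : mor_class;
  fib : mor_class;
  weq_comp : forall (X Y Z : C) (g : Y ~> Z) (f : X ~> Y),
    weq f -> weq g -> weq (g ∘ f);
  weq_cancell : forall (X Y Z : C) (g : Y ~> Z) (f : X ~> Y),
    weq g -> weq (g ∘ f) -> weq f;
  weq_cancelr : forall (X Y Z : C) (g : Y ~> Z) (f : X ~> Y),
    weq f -> weq (g ∘ f) -> weq g;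
  weq_retract : retract_closed weq;
  cof_retract : retract_closed cof;
  fib_retract : retract_closed fib;
  cof_tfib_lifting : forall (A B X Y : C) (i : A ~> B) (p : X ~> Y),
    cof i -> fib p -> weq p -> has_lifting i p;
  tcof_fib_lifting : forall (A B X Y : C) (i : A ~> B) (p : X ~> Y),
    cof i -> weq i -> fib p -> has_lifting i p;
  cof_tfib_factor : forall (X Y : C) (f : X ~> Y),
    exists (Z : C) (i : X ~> Z) (p : Z ~> Y),
      [/\ cof i, fib p, weq p & p ∘ i = f];
  tcof_fib_factor : forall (X Y : C) (f : X ~> Y),
    exists (Z : C) (i : X ~> Z) (p : Z ~> Y),
      [/\ cof i, weq i, fib p & p ∘ i = f]
}.

Definition fibrant (M : model_structure) (X : C) : Prop :=
  exists (T : C) (f : X ~> T), is_terminal T /\ fib M f.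

Variable A : C.

Record slice_obj := SliceObj { slice_dom : C; slice_map : slice_dom ~> A }.

Record slice_hom (X Y : slice_obj) := SliceHom {
  slice_mor : slice_dom X ~> slice_dom Y;
  slice_morP : slice_map Y ∘ slice_mor = slice_map X
}.

Lemma slice_hom_eq (X Y : slice_obj) (f g : slice_hom X Y) :
  slice_mor f = slice_mor g -> f = g.
Proof.
case: f g => [f fP] [g gP] /= efg; move: fP; rewrite efg => fP.
by congr SliceHom; apply: Prop_irrelevance.
Qed.

Definition slice_id (X : slice_obj) : slice_hom X X :=
  SliceHom (comp_idr (slice_map X)).

Lemma slice_comp_subproof (X Y Z : slice_obj)
    (g : slice_hom Y Z) (f : slice_hom X Y) :
  slice_map Z ∘ (slice_mor g ∘ slice_mor f) = slice_map X.
Proof. by rewrite comp_assoc !slice_morP. Qed.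

Definition slice_comp (X Y Z : slice_obj)
    (g : slice_hom Y Z) (f : slice_hom X Y) : slice_hom X Z :=
  SliceHom (slice_comp_subproof g f).

Program Definition slice : category :=
  @Category slice_obj slice_hom slice_id slice_comp _ _ _.
Next Obligation. by move=> X Y f; apply/slice_hom_eq/comp_idl. Qed.
Next Obligation. by move=> X Y f; apply/slice_hom_eq/comp_idr. Qed.
Next Obligation. by move=> W X Y Z h g f; apply/slice_hom_eq/comp_assoc. Qed.

Definition slice_over (X Y : C) (q : Y ~> A) (f : X ~> Y) :
    (SliceObj (q ∘ f) : slice) ~> (SliceObj q : slice) :=
  @SliceHom (SliceObj (q ∘ f)) (SliceObj q) f erefl.

End CategoryNotions.

(** In the simplex category, the natural number [n] stands for the poset
    {0 < ... < n}, that is, for ['I_n.+1]. *)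
Definition monotone m n (f : {ffun 'I_m.+1 -> 'I_n.+1}) : bool :=
  [forall i : 'I_m.+1, forall j : 'I_m.+1, (i <= j) ==> (f i <= f j)].

Definition dhom m n := {f : {ffun 'I_m.+1 -> 'I_n.+1} | monotone f}.

Definition dfun m n (f : dhom m n) : 'I_m.+1 -> 'I_n.+1 := val f.
Coercion dfun : dhom >-> Funclass.

Lemma dhom_eq m n (f g : dhom m n) : f =1 g -> f = g.
Proof. by move=> efg; apply/val_inj/ffunP. Qed.

Lemma dhom_mono m n (f : dhom m n) (i j : 'I_m.+1) : i <= j -> f i <= f j.
Proof. by move=> ij; have /forallP/(_ i)/forallP/(_ j)/implyP := valP f; apply. Qed.

Lemma dmk_subproof m n (f : 'I_m.+1 -> 'I_n.+1) :
  {homo f : i j / i <= j} -> monotone [ffun i => f i].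
Proof.
move=> fm; apply/forallP => i; apply/forallP => j; apply/implyP => ij.
by rewrite !ffunE; apply: fm.
Qed.

Definition dmk m n (f : 'I_m.+1 -> 'I_n.+1) (fm : {homo f : i j / i <= j}) :
  dhom m n := exist _ [ffun i => f i] (dmk_subproof fm).

Lemma dmkE m n (f : 'I_m.+1 -> 'I_n.+1) (fm : {homo f : i j / i <= j}) :
  dmk fm =1 f.
Proof. by move=> i; rewrite /dfun /= ffunE. Qed.

Lemma did_subproof n : {homo (fun i : 'I_n.+1 => i) : i j / i <= j}.
Proof. by []. Qed.

Definition did n : dhom n n := dmk (@did_subproof n).

Lemma dcomp_subproof l m n (g : dhom m n) (f : dhom l m) :
  {homo (fun i => g (f i)) : i j / i <= j}.
Proof. by move=> i j ij; do 2!apply: dhom_mono. Qed.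

Definition dcomp l m n (g : dhom m n) (f : dhom l m) : dhom l n :=
  dmk (dcomp_subproof g f).

Lemma dcompE l m n (g : dhom m n) (f : dhom l m) i : dcomp g f i = g (f i).
Proof. exact: dmkE. Qed.

Lemma dop_subproof m n (f : dhom m n) :
  {homo (fun i => rev_ord (f (rev_ord i))) : i j / i <= j}.
Proof.
move=> i j ij /=; apply/leq_sub2l; rewrite ltnS.
by apply: dhom_mono; apply/leq_sub2l; rewrite ltnS.
Qed.

(** The automorphism of the simplex category reversing the orders. *)
Definition dop m n (f : dhom m n) : dhom m n := dmk (dop_subproof f).

Lemma dop_id n : dop (did n) = did n.
Proof. by apply: dhom_eq => i; rewrite !dmkE rev_ordK. Qed.

Lemma dop_comp l m n (g : dhom m n) (f : dhom l m) :
  dop (dcomp g f) = dcomp (dop g) (dop f).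
Proof. by apply: dhom_eq => i; rewrite !dmkE rev_ordK. Qed.

Record sset := SSet {
  cell :> nat -> Type;
  act : forall m n, dhom m n -> cell n -> cell m;
  act_id : forall n (x : cell n), act (did n) x = x;
  act_comp : forall l m n (g : dhom m n) (f : dhom l m) (x : cell n),
    act (dcomp g f) x = act f (act g x)
}.

Record smap (X Y : sset) := SMap {
  sfun :> forall n, X n -> Y n;
  sfun_nat : forall m n (f : dhom m n) (x : X n),
    sfun (act f x) = act f (sfun x)
}.

Lemma smap_eq (X Y : sset) (f g : smap X Y) :
  (forall n (x : X n), f n x = g n x) -> f = g.
Proof.
case: f g => [f fP] [g gP] /= efg.
have {}efg : f = g by apply: functional_extensionality_dep => n; apply/funext.
by move: fP; rewrite efg => fP; congr SMap; apply: Prop_irrelevance.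
Qed.

Definition smap_id (X : sset) : smap X X :=
  @SMap X X (fun _ x => x) (fun _ _ _ _ => erefl).

Lemma smap_comp_subproof (X Y Z : sset) (g : smap Y Z) (f : smap X Y)
    m n (a : dhom m n) (x : X n) : g m (f m (act a x)) = act a (g n (f n x)).
Proof. by rewrite !sfun_nat. Qed.

Definition smap_comp (X Y Z : sset) (g : smap Y Z) (f : smap X Y) : smap X Z :=
  SMap (smap_comp_subproof g f).

Program Definition sSet : category :=
  @Category sset smap smap_id smap_comp _ _ _.
Next Obligation. by move=> X Y f; apply: smap_eq. Qed.
Next Obligation. by move=> X Y f; apply: smap_eq. Qed.
Next Obligation. by move=> W X Y Z h g f; apply: smap_eq. Qed.

Program Definition sop (X : sSet) : sSet :=
  @SSet (cell X) (fun _ _ a x => act (dop a) x) _ _.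
Next Obligation. by move=> X n x /=; rewrite dop_id act_id. Qed.
Next Obligation. by move=> X l m n g f x /=; rewrite dop_comp act_comp. Qed.

Definition sop_map (X Y : sSet) (p : X ~> Y) : sop X ~> sop Y :=
  @SMap (sop X) (sop Y) (@sfun X Y p) (fun m n a => sfun_nat p (dop a)).

Program Definition Simplex (n : nat) : sSet :=
  @SSet (fun m => dhom m n) (fun _ _ a x => dcomp x a) _ _.
Next Obligation. by move=> n m x; apply: dhom_eq => i; rewrite !dmkE. Qed.
Next Obligation. by move=> n l m k g f x; apply: dhom_eq => i; rewrite !dmkE. Qed.

Program Definition simplex_map m n (a : dhom m n) : Simplex m ~> Simplex n :=
  @SMap (Simplex m) (Simplex n) (fun _ x => dcomp a x) _.
Next Obligation. by move=> m n a l k f x; apply: dhom_eq => i; rewrite !dmkE. Qed.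

(** A simplex of [Simplex n] lies in the [k]-th horn when it lies in the face
    opposite to some vertex [j != k]. *)
Definition in_horn n (k : 'I_n.+1) m (a : dhom m n) : bool :=
  [exists j, (j != k) && [forall i, a i != j]].

Lemma in_horn_act n (k : 'I_n.+1) l m (f : dhom l m) (a : dhom m n) :
  in_horn k a -> in_horn k (dcomp a f).
Proof.
case/existsP => j /andP[jk /forallP aj]; apply/existsP; exists j.
by rewrite jk; apply/forallP => i; rewrite dcompE.
Qed.

Program Definition Horn (n : nat) (k : 'I_n.+1) : sSet :=
  @SSet (fun m => {a : dhom m n | in_horn k a})
    (fun _ _ f x => exist _ (dcomp (val x) f) (in_horn_act f (valP x))) _ _.
Next Obligation.
by move=> n k m x; apply/val_inj/dhom_eq => i; rewrite /= !dmkE.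
Qed.
Next Obligation.
by move=> n k l m r g f x; apply/val_inj/dhom_eq => i; rewrite /= !dmkE.
Qed.

Definition horn_incl n (k : 'I_n.+1) : Horn k ~> Simplex n :=
  @SMap (Horn k) (Simplex n) (fun _ x => val x) (fun _ _ _ _ => erefl).

Definition inner_fibration (X Y : sSet) (p : X ~> Y) : Prop :=
  forall n (k : 'I_n.+1), 0 < k < n -> has_lifting (horn_incl k) p.

Definition right_fibration (X Y : sSet) (p : X ~> Y) : Prop :=
  forall n (k : 'I_n.+1), 0 < n -> 0 < k <= n -> has_lifting (horn_incl k) p.

Definition left_fibration (X Y : sSet) (p : X ~> Y) : Prop :=
  forall n (k : 'I_n.+1), 0 < n -> 0 <= k < n -> has_lifting (horn_incl k) p.

(** The edge {n-1, n} of the [n]-simplex. The condition [2 <= n] is encoded by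
    [n = m.+2]; it is what makes this edge lie in the last horn. *)
Lemma last_edge_subproof m :
  {homo (fun i : 'I_2 => inord (m.+1 + i) : 'I_m.+3) : i j / i <= j}.
Proof.
move=> i j ij; have lt (l : 'I_2) : m.+1 + l < m.+3.
  by rewrite addSn !ltnS -[m.+1]addn1 leq_add2l -ltnS; case: l.
by rewrite !inordK ?lt // leq_add2l.
Qed.

Definition last_edge m : dhom 1 m.+2 := dmk (@last_edge_subproof m).

Lemma last_edge_horn m l (x : dhom l 1) :
  in_horn (ord_max : 'I_m.+3) (dcomp (last_edge m) x).
Proof.
apply/existsP; exists ord0; apply/andP; split=> //; apply/forallP => i.
rewrite dcompE dmkE -val_eqE /= inordK //.
by rewrite addSn !ltnS -[m.+1]addn1 leq_add2l -ltnS; case: (x i).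
Qed.

Program Definition last_edge_in_horn m :
    Simplex 1 ~> Horn (ord_max : 'I_m.+3) :=
  @SMap (Simplex 1) (Horn (ord_max : 'I_m.+3))
    (fun _ x => exist _ (dcomp (last_edge m) x) (last_edge_horn m x)) _.
Next Obligation.
by move=> m l k f x; apply/val_inj/dhom_eq => i; rewrite /= !dmkE.
Qed.

Definition cartesian_edge (X Y : sSet) (p : X ~> Y) (f : Simplex 1 ~> X) : Prop :=
  forall m (u : Horn (ord_max : 'I_m.+3) ~> X) (v : Simplex m.+2 ~> Y),
    p ∘ u = v ∘ horn_incl ord_max -> u ∘ last_edge_in_horn m = f ->
    exists h, is_lift (horn_incl ord_max) p u v h.

Lemma vertex_subproof n (k : 'I_n.+1) :
  {homo (fun _ : 'I_1 => k) : i j / i <= j}.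
Proof. by []. Qed.

Definition vertex n (k : 'I_n.+1) : Simplex 0 ~> Simplex n :=
  simplex_map (dmk (vertex_subproof k)).

(** The inclusion of the vertex {1} into the 1-simplex is [vertex ord_max]. *)
Definition cartesian_fibration (X Y : sSet) (p : X ~> Y) : Prop :=
  inner_fibration p /\
  forall (x : Simplex 0 ~> X) (e : Simplex 1 ~> Y),
    p ∘ x = e ∘ vertex ord_max ->
    exists h, is_lift (vertex ord_max) p x e h /\ cartesian_edge p h.

Definition cocartesian_fibration (X Y : sSet) (p : X ~> Y) : Prop :=
  cartesian_fibration (sop_map p).

(** A model structure is determined by its cofibrations and its fibrant
    objects, so at most one model structure on [slice A] (up to equivalence of
    the three classes) is contravariant, resp. covariant. The quantifier
    [exists M] in [final] and [initial] picks out that model structure. *)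
Definition is_contravariant (A : sSet) (M : model_structure (slice A)) : Prop :=
  (forall (X Y : slice A) (f : X ~> Y), cof M f <-> is_mono f) /\
  (forall X : slice A, fibrant M X <-> right_fibration (slice_map X)).

Definition is_covariant (A : sSet) (M : model_structure (slice A)) : Prop :=
  (forall (X Y : slice A) (f : X ~> Y), cof M f <-> is_mono f) /\
  (forall X : slice A, fibrant M X <-> left_fibration (slice_map X)).

Definition final (X Y : sSet) (f : X ~> Y) : Prop :=
  forall (A : sSet) (q : Y ~> A),
    exists M : model_structure (slice A),
      is_contravariant M /\ weq M (slice_over q f).

Definition initial (X Y : sSet) (f : X ~> Y) : Prop :=
  forall (A : sSet) (q : Y ~> A),
    exists M : model_structure (slice A),
      is_covariant M /\ weq M (slice_over q f).

(** In the two definitions below the diagram is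
      A' --w--> B' --b'--> X
      |a        |b         |p
      A  --v--> B  --c---> Y                                            *)
Definition proper (X Y : sSet) (p : X ~> Y) : Prop :=
  forall (A B A' B' : sSet) (v : A ~> B) (c : B ~> Y) (w : A' ~> B')
    (b' : B' ~> X) (a : A' ~> A) (b : B' ~> B),
    is_pullback w a b v -> is_pullback b' b p c -> final v -> final w.

Definition smooth (X Y : sSet) (p : X ~> Y) : Prop :=
  forall (A B A' B' : sSet) (v : A ~> B) (c : B ~> Y) (w : A' ~> B')
    (b' : B' ~> X) (a : A' ~> A) (b : B' ~> B),
    is_pullback w a b v -> is_pullback b' b p c -> initial v -> initial w.

(* Main.v *)
(** Write [efib e], for an end [e] of the interval, for the maps having the right
    lifting property against the inclusions [T x {e} U P x D1 -> T x D1]. Right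
    fibrations are [efib true] and left fibrations are [efib false]: one
    direction fills prisms by horns, the other exhibits a horn inclusion as a
    retract of such an inclusion by pushing the simplex to the vertex [k].

    Filling prisms also shows that homotopies ending (resp. starting) at a given
    map lift along Cartesian (resp. coCartesian) fibrations [p]. Pushing
    [T x D1] towards its end [e] and lifting this homotopy along [p] turns the
    preimage under [p] of [T x {e} U P x D1] into a deformation retract, so
    pulling back along [p] preserves the left lifting property against [efib e]; by
    adjunction this says that the dependent product along [p] preserves [efib e].

    In a model structure on [sSet/A] whose cofibrations are the monomorphisms and
    whose fibrant objects are the maps in [efib e], a cylinder is provided by the
    nerve [J] of the contractible groupoid on two objects. One gets that maps with
    the left lifting property against [efib e] are weak equivalences and that
    trivial cofibrations with fibrant target have this property. Hence a
    final map factors as such a map followed by a trivial fibration, and both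
    factors are stable under pullback along [p]. The contravariant model structure
    over a nonempty base [S] exists because the finality of [v] may be tested
    against a constant map to [S]. *)
From mathcomp Require Import all_boot boolp classical_sets zify.
Require Import Defs.

Set Implicit Arguments.
Unset Strict Implicit.
Unset Printing Implicit Defensive.
#[local] Obligation Tactic := idtac.
Local Open Scope cat_scope.

(** * Simplicial sets, lifting properties and anodyne maps *)

Section GenericLifting.
Variable C : category.

Lemma has_lifting_retract (A B A' B' X Y : C) (i : A ~> B) (i' : A' ~> B')
    (p : X ~> Y) : is_retract i i' -> has_lifting i' p -> has_lifting i p.
Proof.
move=> [s [r [s' [r' [rs rs' e1 e2]]]]] lp u v uv.
have [|h [h1 h2]] := lp (u ∘ r) (v ∘ r').
  by rewrite comp_assoc uv -!comp_assoc e2.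
exists (h ∘ s'); split.
  by rewrite -comp_assoc -e1 comp_assoc h1 -comp_assoc rs comp_idr.
by rewrite comp_assoc h2 -comp_assoc rs' comp_idr.
Qed.

Lemma has_lifting_comp (A B X Y Z : C) (i : A ~> B) (p : X ~> Y) (q : Y ~> Z) :
  has_lifting i p -> has_lifting i q -> has_lifting i (q ∘ p).
Proof.
move=> lp lq u v uv.
have [|h [h1 h2]] := lq (p ∘ u) v; first by rewrite comp_assoc.
have [|k [k1 k2]] := lp u h; first by rewrite h1.
by exists k; split=> //; rewrite -comp_assoc k2.
Qed.

Lemma has_lifting_pullback (A B P X Y Z : C) (i : A ~> B)
    (f' : P ~> X) (g' : P ~> Z) (g : X ~> Y) (f : Z ~> Y) :
  is_pullback f' g' g f -> has_lifting i g -> has_lifting i g'.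
Proof.
move=> [sq uni] lg u v uv.
have [|h [h1 h2]] := lg (f' ∘ u) (f ∘ v).
  by rewrite comp_assoc sq -!comp_assoc uv.
have [k [k1 k2 _]] := uni _ h v h2.
exists k; split=> //.
have [|l [_ _ l_uniq]] := uni _ (f' ∘ u) (g' ∘ u).
  by rewrite !comp_assoc sq.
have -> : u = l by apply: l_uniq.
by apply: l_uniq; rewrite comp_assoc ?k1 ?k2 ?h1.
Qed.

Lemma is_pullback_sym (P X Y Z : C)
    (f' : P ~> X) (g' : P ~> Z) (g : X ~> Y) (f : Z ~> Y) :
  is_pullback f' g' g f -> is_pullback g' f' f g.
Proof.
move=> [sq uni]; split=> // Q a b ab.
have [h [h1 h2 hu]] := uni Q b a (esym ab).
by exists h; split=> // k k1 k2; apply: hu.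
Qed.

End GenericLifting.

Lemma dcomp_idl m n (f : dhom m n) : dcomp (did n) f = f.
Proof. by apply: dhom_eq => i; rewrite !dmkE. Qed.

Lemma dcomp_idr m n (f : dhom m n) : dcomp f (did m) = f.
Proof. by apply: dhom_eq => i; rewrite !dmkE. Qed.

Lemma dcompA k l m n (h : dhom m n) (g : dhom l m) (f : dhom k l) :
  dcomp h (dcomp g f) = dcomp (dcomp h g) f.
Proof. by apply: dhom_eq => i; rewrite !dcompE. Qed.

Lemma to0_eq m (a b : dhom m 0) : a = b.
Proof. by apply: dhom_eq => i; rewrite !ord1. Qed.

Lemma smap_compE (X Y Z : sSet) (g : Y ~> Z) (f : X ~> Y) n (x : X n) :
  (g ∘ f) n x = g n (f n x).
Proof. by []. Qed.

Lemma smap_congr (X Y : sSet) (f g : X ~> Y) n (x : X n) :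
  f = g -> f n x = g n x.
Proof. by move->. Qed.

Program Definition yo (X : sSet) n (x : X n) : Simplex n ~> X :=
  @SMap (Simplex n) X (fun m (a : dhom m n) => act a x) _.
Next Obligation. by move=> X n x l m f a; rewrite -act_comp. Qed.

Lemma yoE (X : sSet) n (x : X n) m (a : dhom m n) : yo x m a = act a x.
Proof. by []. Qed.

(** Choice turns a total functional relation into functions, and uniqueness of values makes them
    commute with the simplicial action. Maps defined by cases on a union of subobjects are built
    this way. *)
Lemma graph_map (B X : sSet) (G : forall n, B n -> X n -> Prop) :
    (forall m n (f : dhom m n) b x, G n b x -> G m (act f b) (act f x)) ->
    (forall n b, exists x, G n b x) ->
    (forall n b x x', G n b x -> G n b x' -> x = x') ->
  exists f : B ~> X, forall n b, G n b (f n b).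
Proof.
move=> Gact Gex Guni.
pose f n b := proj1_sig (cid (Gex n b)).
have fP n b : G n b (f n b) by rewrite /f; case: cid.
have fnat m n (a : dhom m n) b : f m (act a b) = act a (f n b).
  by apply: Guni (fP _ _) _; apply: Gact.
by exists (@SMap B X f fnat).
Qed.

Record sub (X : sset) := Sub {
  subP :> forall n, X n -> Prop;
  sub_act : forall m n (f : dhom m n) x, subP x -> subP (act f x)
}.

Program Definition ssub (X : sSet) (P : sub X) : sSet :=
  @SSet (fun n => {x : X n | P n x})
    (fun _ _ f x => exist _ (act f (proj1_sig x)) (sub_act f (proj2_sig x))) _ _.
Next Obligation. by move=> X P n [x Px]; apply: eq_exist; rewrite /= act_id. Qed.
Next Obligation.
by move=> X P l m n g f [x Px]; apply: eq_exist; rewrite /= act_comp.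
Qed.

Definition sub_incl (X : sSet) (P : sub X) : ssub P ~> X :=
  @SMap (ssub P) X (fun _ x => proj1_sig x) (fun _ _ _ _ => erefl).

Definition injective_smap (X Y : sset) (f : smap X Y) : Prop :=
  forall n, injective (f n).

Lemma sub_incl_inj (X : sSet) (P : sub X) : injective_smap (sub_incl P).
Proof. by move=> n [x Px] [y Py] /= exy; apply: eq_exist. Qed.

Program Definition im_sub (X Y : sSet) (f : X ~> Y) : sub Y :=
  @Sub Y (fun n y => exists x : X n, y = f n x) _.
Next Obligation.
by move=> X Y f m n a y [x ->]; exists (act a x); rewrite sfun_nat.
Qed.

Program Definition preim_sub (X Y : sSet) (f : X ~> Y) (P : sub Y) : sub X :=
  @Sub X (fun n x => P n (f n x)) _.
Next Obligation.
by move=> X Y f P m n a x Px; rewrite /= sfun_nat; apply: sub_act.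
Qed.

Program Definition sprod (X Y : sSet) : sSet :=
  @SSet (fun n => (X n * Y n)%type)
    (fun _ _ f x => (act f x.1, act f x.2)) _ _.
Next Obligation. by move=> X Y n [x y]; rewrite /= !act_id. Qed.
Next Obligation. by move=> X Y l m n g f [x y]; rewrite /= !act_comp. Qed.

Definition spr1 (X Y : sSet) : sprod X Y ~> X :=
  @SMap (sprod X Y) X (fun _ x => x.1) (fun _ _ _ _ => erefl).
Definition spr2 (X Y : sSet) : sprod X Y ~> Y :=
  @SMap (sprod X Y) Y (fun _ x => x.2) (fun _ _ _ _ => erefl).

Program Definition spair (Z X Y : sSet) (f : Z ~> X) (g : Z ~> Y) :
    Z ~> sprod X Y :=
  @SMap Z (sprod X Y) (fun n z => (f n z, g n z)) _.
Next Obligation. by move=> Z X Y f g m n a z; rewrite /= !sfun_nat. Qed.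

(** An injective map is isomorphic to the inclusion of its image, and an isomorphism of arrows is a
    retract in both directions. Monomorphisms can thus be traded for inclusions [sub_incl]. *)
Lemma im_retract (A B : sSet) (i : A ~> B) : injective_smap i ->
  is_retract i (sub_incl (im_sub i)) /\ is_retract (sub_incl (im_sub i)) i.
Proof.
move=> inj_i.
have [r rP] := @graph_map (ssub (im_sub i)) A
    (fun n y a => proj1_sig y = i n a)
    (fun m n f y a => fun e => etrans (f_equal (act f) e) (esym (sfun_nat i f a)))
    (fun n y => proj2_sig y)
    (fun n y a a' e e' => inj_i n _ _ (etrans (esym e) e')).
have s_nat m n (f : dhom m n) (a : A n) :
    exist (fun y => exists x, y = i m x) (i m (act f a)) (ex_intro _ (act f a) erefl) =
    act f (exist _ (i n a) (ex_intro _ a erefl) : ssub (im_sub i) n).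
  by apply: eq_exist; rewrite sfun_nat.
pose s : A ~> ssub (im_sub i) := @SMap A (ssub (im_sub i)) _ s_nat.
have rs : r ∘ s = idm A.
  by apply: smap_eq => n a; apply: inj_i; rewrite smap_compE -rP.
have sr : s ∘ r = idm (ssub (im_sub i)).
  by apply: smap_eq => n y; apply: (@sub_incl_inj _ (im_sub i)); rewrite /= -rP.
have si : sub_incl (im_sub i) ∘ s = i by apply: smap_eq.
have ir : i ∘ r = sub_incl (im_sub i).
  by apply: smap_eq => n y; rewrite smap_compE -rP.
split; [exists s, r, (idm B), (idm B)|exists r, s, (idm B), (idm B)];
  by split; rewrite ?comp_idl.
Qed.

Lemma has_lifting_inj (A B X Y : sSet) (i : A ~> B) (p : X ~> Y) :
  injective_smap i -> has_lifting (sub_incl (im_sub i)) p -> has_lifting i p.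
Proof. by move=> /im_retract[ret _]; apply: has_lifting_retract. Qed.

Lemma sub_retract (B B' : sSet) (E : sub B) (E' : sub B')
    (s : B ~> B') (r : B' ~> B) :
    r ∘ s = idm B ->
    (forall n b, E n b -> E' n (s n b)) -> (forall n b, E' n b -> E n (r n b)) ->
  is_retract (sub_incl E) (sub_incl E').
Proof.
move=> rs sE rE.
have s_nat m n (f : dhom m n) (b : ssub E n) :
    exist (E' m) (s m (proj1_sig (act f b))) (sE _ _ (proj2_sig (act f b))) =
    act f (exist _ (s n (proj1_sig b)) (sE _ _ (proj2_sig b)) : ssub E' n).
  by apply: eq_exist; rewrite /= sfun_nat.
have r_nat m n (f : dhom m n) (b : ssub E' n) :
    exist (E m) (r m (proj1_sig (act f b))) (rE _ _ (proj2_sig (act f b))) =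
    act f (exist _ (r n (proj1_sig b)) (rE _ _ (proj2_sig b)) : ssub E n).
  by apply: eq_exist; rewrite /= sfun_nat.
exists (@SMap (ssub E) (ssub E') _ s_nat), (@SMap (ssub E') (ssub E) _ r_nat), s, r.
split=> //.
- apply: smap_eq => n b; apply: (@sub_incl_inj _ E); rewrite /=.
  exact: (smap_congr (proj1_sig b) rs).
- exact: smap_eq.
- exact: smap_eq.
Qed.

Section Pullback.
Variables (X Y Z : sSet) (g : X ~> Y) (f : Z ~> Y).

Program Definition pb_sub : sub (sprod X Z) :=
  @Sub (sprod X Z) (fun n x => g n x.1 = f n x.2) _.
Next Obligation. by move=> m n a [x z] /= e; rewrite !sfun_nat e. Qed.

Definition pb : sSet := ssub pb_sub.
Definition pb1 : pb ~> X := spr1 X Z ∘ sub_incl pb_sub.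
Definition pb2 : pb ~> Z := spr2 X Z ∘ sub_incl pb_sub.

Lemma pb_sq : g ∘ pb1 = f ∘ pb2.
Proof. by apply: smap_eq => n [[x z] e]. Qed.

Lemma pb_sqE n (x : pb n) : g n (pb1 n x) = f n (pb2 n x).
Proof. exact: (smap_congr x pb_sq). Qed.

Lemma pb_eq n (x y : pb n) : pb1 n x = pb1 n y -> pb2 n x = pb2 n y -> x = y.
Proof.
case: x y => [[x z] e] [[x' z'] e'] /= ex ez.
by apply: eq_exist; rewrite ex ez.
Qed.

Lemma pb_ex n (x : X n) (z : Z n) : g n x = f n z ->
  exists w : pb n, pb1 n w = x /\ pb2 n w = z.
Proof. by move=> e; exists (exist _ (x, z) e). Qed.

Lemma pb_map (Q : sSet) (a : Q ~> X) (b : Q ~> Z) : g ∘ a = f ∘ b ->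
  exists h : Q ~> pb, pb1 ∘ h = a /\ pb2 ∘ h = b.
Proof.
move=> ab.
have h_nat m n (k : dhom m n) (q : Q n) :
   exist (fun x => g m x.1 = f m x.2) (a m (act k q), b m (act k q))
     (smap_congr (act k q) ab) =
   act k (exist _ (a n q, b n q) (smap_congr q ab) : pb n).
  by apply: eq_exist; rewrite /= !sfun_nat.
exists (@SMap Q pb _ h_nat); split; exact: smap_eq.
Qed.

Lemma pb_pullback : is_pullback pb1 pb2 g f.
Proof.
split; first exact: pb_sq.
move=> Q a b ab; have [h [h1 h2]] := pb_map ab.
exists h; split=> // k k1 k2; apply: smap_eq => n q; apply: pb_eq.
  by rewrite -!smap_compE k1 h1.
by rewrite -!smap_compE k2 h2.
Qed.

End Pullback.

Section PullbackCells.
Variables (P X Y Z : sSet) (f' : P ~> X) (g' : P ~> Z) (g : X ~> Y) (f : Z ~> Y).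
Hypothesis pbP : is_pullback f' g' g f.

(** By the Yoneda lemma, testing the universal property on [Simplex n] shows that an abstract
    cartesian square is computed cell by cell. *)
Lemma pullback_cell n (x : X n) (z : Z n) : g n x = f n z ->
  exists y : P n, f' n y = x /\ g' n y = z.
Proof.
move=> e; have [|h [h1 h2 _]] := pbP.2 (Simplex n) (yo x) (yo z).
  by apply: smap_eq => m a /=; rewrite !sfun_nat e.
exists (h n (did n)); split; rewrite -smap_compE ?h1 ?h2 /= act_id //.
Qed.

Lemma pullback_inj n (y y' : P n) : f' n y = f' n y' -> g' n y = g' n y' -> y = y'.
Proof.
move=> e1 e2; have [|h [_ _ hu]] := pbP.2 (Simplex n) (yo (f' n y)) (yo (g' n y)).
  by apply: smap_eq => m a /=; rewrite !sfun_nat; congr act; apply: (smap_congr y pbP.1).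
have h1 : yo y = h.
  by apply: hu; apply: smap_eq => m a /=; rewrite sfun_nat.
have h2 : yo y' = h.
  by apply: hu; apply: smap_eq => m a /=; rewrite sfun_nat ?e1 ?e2.
by rewrite -(act_id y) -(act_id y') -!yoE h1 h2.
Qed.
End PullbackCells.

Notation D1 := (Simplex 1).

Definition stays (e : bool) m (c : dhom m 1) : Prop := forall i, c i = e :> nat.

Lemma stays_act e l m (f : dhom l m) (c : dhom m 1) :
  stays e c -> stays e (dcomp c f).
Proof. by move=> ce i; rewrite dcompE. Qed.

Definition end_vertex (e : bool) : 'I_2 := inord e.

Definition dconst m (e : bool) : dhom m 1 :=
  dmk (fun (i j : 'I_m.+1) (_ : i <= j) => leqnn (end_vertex e)).

Lemma dconstE m e (i : 'I_m.+1) : dconst m e i = e :> nat.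
Proof. by rewrite dmkE inordK //; case: e. Qed.

Lemma stays_dconst e m : stays e (dconst m e).
Proof. by move=> i; apply: dconstE. Qed.

Lemma staysE e m (c : dhom m 1) : stays e c -> c = dconst m e.
Proof. by move=> ce; apply: dhom_eq => i; apply: val_inj; rewrite /= ce dconstE. Qed.

Lemma dconst_act e l m (f : dhom l m) : dcomp (dconst m e) f = dconst l e.
Proof. by apply: staysE => i; rewrite dcompE dconstE. Qed.

(** The inclusion [P x Delta^1 U T x {e} -> T x Delta^1]. *)
Program Definition box_sub (T : sSet) (P : sub T) (e : bool) : sub (sprod T D1) :=
  @Sub (sprod T D1) (fun n x => P n x.1 \/ stays e x.2) _.
Next Obligation.
move=> T P e m n f [t c] /= [Pt|ce]; [left; exact: sub_act|right; exact: stays_act].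
Qed.

Definition box (T : sSet) (P : sub T) (e : bool) := sub_incl (box_sub P e).

Program Definition sub0 (T : sSet) : sub T := @Sub T (fun _ _ => False) _.
Next Obligation. by []. Qed.

Definition efib (e : bool) (X Y : sSet) (q : X ~> Y) : Prop :=
  forall (T : sSet) (P : sub T), has_lifting (box P e) q.

(** For empty [P] the box is the inclusion of [T x {e}] into [T x Delta^1], so this is the lifting
    of homotopies whose end [e] is prescribed. *)
Definition path_lifting (e : bool) (X Y : sSet) (p : X ~> Y) : Prop :=
  forall T : sSet, has_lifting (box (sub0 T) e) p.

Definition eanodyne (e : bool) (A B : sSet) (i : A ~> B) : Prop :=
  forall (X Y : sSet) (q : X ~> Y), efib e q -> has_lifting i q.

Definition at_end (T : sSet) (e : bool) : T ~> sprod T D1.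
refine (spair (idm T) (@SMap T D1 (fun n _ => dconst n e) _)).
by move=> m n f x; rewrite /= dconst_act.
Defined.

Lemma box_anodyne e (T : sSet) (P : sub T) : eanodyne e (box P e).
Proof. by move=> X Y q; apply. Qed.

Lemma eanodyne_retract e (A B A' B' : sSet) (i : A ~> B) (i' : A' ~> B') :
  is_retract i i' -> eanodyne e i' -> eanodyne e i.
Proof. by move=> ret an X Y q Fq; apply: has_lifting_retract ret (an _ _ _ Fq). Qed.

(** Embedding [B] at the end [~~ e] of [B x Delta^1] and returning by [r] exhibits the inclusion of
    [E] as a retract of a box inclusion. *)
Lemma deformation_anodyne e (B : sSet) (E : sub B) (r : sprod B D1 ~> B) :
    (forall n b, r n (b, dconst n (~~ e)) = b) ->
    (forall n b c, E n b \/ stays e c -> E n (r n (b, c))) ->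
  eanodyne e (sub_incl E).
Proof.
move=> r1 rE; apply: (@eanodyne_retract e _ _ _ _ _ (box E e)); last exact: box_anodyne.
apply: (@sub_retract _ _ E (box_sub E e) (at_end B (~~ e)) r).
- by apply: smap_eq => n b /=; rewrite r1.
- by move=> n b Eb; left.
- by move=> n [b c]; apply: rE.
Qed.

(** * Partial lifts *)

(** Such an [a] is a simplex of the boundary of the [n]-simplex. *)
Definition skips m n (a : dhom m n) : Prop := exists j, forall i, a i != j.

Lemma skips_factor m n (a : dhom m n.+1) : skips a ->
  exists (d : dhom n n.+1) (a' : dhom m n), skips d /\ a = dcomp d a'.
Proof.
move=> [j aj].
have lift_mono : {homo lift j : i i' / i <= i'}.
  by move=> i i' ii'; rewrite /= leq_bump2.
have unb_lt (i : 'I_m.+1) : unbump j (a i) < n.+1.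
  have := aj i; rewrite -val_eqE /= /unbump => /eqP.
  have := ltn_ord (a i); have := ltn_ord j; lia.
have unb_mono : {homo (fun i : 'I_m.+1 => Ordinal (unb_lt i)) : i i' / i <= i'}.
  by move=> i i' /(dhom_mono a) /=; rewrite /unbump; lia.
exists (dmk lift_mono), (dmk unb_mono); split.
  by exists j => i; rewrite dmkE eq_sym neq_lift.
apply: dhom_eq => i; apply: val_inj; rewrite dcompE !dmkE /= unbumpK //.
by apply: aj.
Qed.

(** A map that misses no vertex is onto. Any set-theoretic section of a monotone surjection between
    finite chains is monotone, so its value over [a i0] may be chosen to be [i0]. *)
Lemma onto_section m n (a : dhom m n) i0 : ~ skips a ->
  exists b : dhom n m, dcomp a b = did n /\ b (a i0) = i0.
Proof.
move=> nsk.
have onto j : exists i, a i = j.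
  apply: contrapT => nj; apply: nsk; exists j => i; apply/eqP => aij.
  by apply: nj; exists i.
pose b (j : 'I_n.+1) := if j == a i0 then i0 else proj1_sig (cid (onto j)).
have ab j : a (b j) = j.
  rewrite /b; case: (j =P a i0) => [e|_]; last by case: cid.
  by rewrite e.
have b_mono : {homo b : j j' / j <= j'}.
  move=> j j' jj'; rewrite leqNgt; apply/negP => lt.
  have := dhom_mono a (ltnW lt); rewrite !ab => j'j.
  suff jj : j = j' by rewrite jj ltnn in lt.
  by apply: val_inj; apply/eqP; rewrite /= eqn_leq jj'.
exists (dmk b_mono); split; first by apply: dhom_eq => i; rewrite dcompE !dmkE ab.
by rewrite dmkE /b eqxx.
Qed.

Lemma onto_endo n (a : dhom n n) : ~ skips a -> a = did n.
Proof.
move=> nsk; have [b [ab _]] := onto_section ord0 nsk.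
have abE j : a (b j) = j by rewrite -dcompE ab dmkE.
(* A section is strictly increasing, hence grows by at least one at each step; bounded by [n], it
   has to be the identity. *)
have step d (i j : 'I_n.+1) : j = i + d :> nat -> b i + d <= b j.
  elim: d j => [|d IH] j jE; first by rewrite addn0; apply: dhom_mono; lia.
  have lt : i + d < n.+1 by have := ltn_ord j; lia.
  have := IH (Ordinal lt) erefl; rewrite addnS; suff : b (Ordinal lt) < b j by lia.
  rewrite ltnNge; apply/negP => /(dhom_mono a); rewrite !abE /=; lia.
have bE i : b i = i.
  apply: val_inj => /=; have := step i ord0 i; have := step (n - i) i ord_max.
  have := ltn_ord i; have := ltn_ord (b ord_max); rewrite /=; lia.
by apply: dhom_eq => i; rewrite dmkE -[in LHS](bE i) abE.
Qed.

Section NonMember.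
Variables (T : sSet) (P : sub T) (n : nat) (t : T n).
Hypothesis notP : ~ P n t.
Hypothesis bdryP : forall m (a : dhom m n), skips a -> P m (act a t).

(** If [a] were onto, a section of it would recover [t] from [act a t] and put [t] in [P]. *)
Lemma nonmember_skips m (a : dhom m n) : P m (act a t) -> skips a.
Proof.
move=> Pa; apply: contrapT => nsk; apply: notP.
have [b [ab _]] := onto_section ord0 nsk.
by rewrite -(act_id t) -ab act_comp; apply: sub_act.
Qed.

(** Composing [a'] with a section of [a] gives an endomorphism fixing [t]. It is onto, as otherwise
    [t] would lie in [P], so it is the identity. With the section through [i], this yields
    [a i = a' i]. *)
Lemma nonmember_inj m (a a' : dhom m n) :
  ~ skips a -> ~ skips a' -> act a t = act a' t -> a = a'.
Proof.
move=> nsk nsk' e; apply: dhom_eq => i.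
have [b [ab bi]] := onto_section i nsk.
have tE : act (dcomp a' b) t = t by rewrite act_comp -e -act_comp ab act_id.
have/onto_endo a'b : ~ skips (dcomp a' b).
  by move=> sk; apply: notP; rewrite -tE; apply: bdryP.
by rewrite -[in RHS]bi -(dcompE a' b) a'b dmkE.
Qed.
End NonMember.

Section PartialMaps.
Variables (X Y : sSet) (p : X ~> Y) (B : sSet) (v : B ~> Y).

(** A partial lift of [v] through [p], encoded by its graph, so that the domain can grow without any
    change of type. *)
Definition pmap (G : forall n, B n -> X n -> Prop) : Prop :=
  [/\ forall m n (f : dhom m n) b x, G n b x -> G m (act f b) (act f x),
      forall n b x x', G n b x -> G n b x' -> x = x'
    & forall n b x, G n b x -> p n x = v n b].

Definition pdom (G : forall n, B n -> X n -> Prop) n (b : B n) : Prop :=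
  exists x, G n b x.

Definition glue (G : forall n, B n -> X n -> Prop) (K : sSet)
    (s : K ~> B) (h : K ~> X) n b x : Prop :=
  G n b x \/ exists k, b = s n k /\ x = h n k.

Lemma pmap_glue G (K : sSet) (s : K ~> B) (h : K ~> X) :
    pmap G -> p ∘ h = v ∘ s ->
    (forall n k x, G n (s n k) x -> x = h n k) ->
    (forall n k k', s n k = s n k' -> h n k = h n k') ->
  pmap (glue G s h).
Proof.
move=> [Gact Gfun Gover] ph Gh hh; split.
- move=> m n f b x [Gbx|[k [-> ->]]]; first by left; apply: Gact.
  by right; exists (act f k); rewrite !sfun_nat.
- move=> n b x x' [Gx|[k [e ->]]] [Gx'|[k' [e' ->]]].
  + exact: Gfun Gx Gx'.
  + by move: Gx; rewrite e' => /Gh.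
  + by move: Gx'; rewrite e => /Gh.
  + by apply: hh; rewrite -e -e'.
- move=> n b x [|[k [-> ->]]]; first exact: Gover.
  exact: (smap_congr k ph).
Qed.

(** Attaching a cell: the simplex [s] is embedded and meets the domain exactly in a horn, so a
    filler of this horn agrees with [G] on the overlap and extends it over [s]. *)
Lemma pmap_attach G N (s : B N) (k : 'I_N.+1) : pmap G ->
    (forall m (b : dhom m N), pdom G (act b s) <-> in_horn k b) ->
    (forall m (b b' : dhom m N), act b s = act b' s -> b = b') ->
    (forall u : Horn k ~> X, p ∘ u = v ∘ yo s ∘ horn_incl k ->
      (forall m (b : Horn k m), G m (act (val b) s) (u m b)) ->
      exists h, is_lift (horn_incl k) p u (v ∘ yo s) h) ->
  exists G', [/\ pmap G', forall n b x, G n b x -> G' n b x &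
    forall m b, pdom G' b <-> pdom G b \/ exists a : dhom m N, b = act a s].
Proof.
move=> pG Gdom s_inj lift; have [Gact Gfun Gover] := pG.
have [u uG] : exists u : Horn k ~> X, forall m b, G m (act (val b) s) (u m b).
  apply: (@graph_map (Horn k) X (fun m b x => G m (act (val b) s) x)).
  - by move=> m n f b x /(Gact _ _ f); rewrite -act_comp.
  - by move=> n b; apply/Gdom; apply: (valP b).
  - by move=> n b x x'; apply: Gfun.
have [|h [h1 h2]] := lift u _ uG.
  by apply: smap_eq => n b; rewrite !smap_compE (Gover _ _ _ (uG n b)).
exists (glue G (yo s) h); split.
- apply: pmap_glue => //.
    move=> n b x Gx; have hb : in_horn k b by apply/Gdom; exists x.
    rewrite (Gfun _ _ _ _ Gx (uG n (exist _ b hb))) -h1 //.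
  by move=> n b b' /s_inj ->.
- by left.
- move=> m b; split.
    by move=> [x [Gx|[a [-> _]]]]; [left; exists x|right; exists a].
  by move=> [[x Gx]|[a ->]]; [exists x; left|exists (h m a); right; exists a].
Qed.

End PartialMaps.

(** * Filling prisms *)

Lemma ord2E (i : 'I_2) : i = 0 :> nat \/ i = 1 :> nat.
Proof. by case: i => [[|[|]]] //= _; [left|right]. Qed.

Section Prism.
Variable n : nat.
Definition prism : sSet := sprod (Simplex n) D1.

Definition pfst m (x : prism m) : dhom m n := x.1.
Definition psnd m (x : prism m) : dhom m 1 := x.2.

Lemma shuffle1_subproof (k : nat) :
  {homo (fun j : 'I_n.+2 => inord (if j <= k then minn j n else j.-1) : 'I_n.+1)
    : i j / i <= j}.
Proof.
have lt (j : 'I_n.+2) : (if j <= k then minn j n else j.-1) < n.+1.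
  by have := ltn_ord j; case: ifP; lia.
by move=> i j ij; rewrite !inordK ?lt //; case: (leqP i k); case: (leqP j k); lia.
Qed.

Lemma shuffle2_subproof (k : nat) :
  {homo (fun j : 'I_n.+2 => end_vertex (k < j)) : i j / i <= j}.
Proof.
by move=> i j ij; rewrite !inordK; case: (ltnP k i); case: (ltnP k j); lia.
Qed.

(** The top-dimensional simplex
    (0,0) < ... < (k,0) < (k,1) < ... < (n,1) of the prism. *)
Definition shuffle k : prism n.+1 :=
  (dmk (@shuffle1_subproof k), dmk (@shuffle2_subproof k)).

Lemma shuffle1E k (j : 'I_n.+2) : k <= n ->
  pfst (shuffle k) j = (if j <= k then j : nat else j.-1) :> nat.
Proof.
by move=> kn; have jn := ltn_ord j; rewrite dmkE inordK; case: (leqP j k); lia.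
Qed.

Lemma shuffle2E k (j : 'I_n.+2) : psnd (shuffle k) j = (k < j) :> nat.
Proof. by rewrite dmkE inordK //; case: (k < j). Qed.

Lemma shuffleE k m (b : dhom m n.+1) i : k <= n ->
  pfst (act b (shuffle k)) i = (if b i <= k then b i : nat else (b i).-1) :> nat /\
  psnd (act b (shuffle k)) i = (k < b i) :> nat.
Proof. by move=> kn; rewrite /= !dcompE shuffle1E // shuffle2E. Qed.

(** The simplices of the prism whose vertices lie on the [k]-th maximal chain. *)
Definition below k m (x : prism m) : Prop :=
  forall i, (psnd x i = 0 :> nat -> pfst x i <= k) /\ (psnd x i = 1 :> nat -> k <= pfst x i).

Lemma belowP k m (x : prism m) : k <= n ->
  below k x <-> exists b : dhom m n.+1, x = act b (shuffle k).
Proof.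
move=> kn; split=> [xk|[b ->] i]; last first.
  by have [-> ->] := shuffleE b i kn; case: leqP; lia.
(* The position of a vertex on a maximal chain is the sum of its coordinates. *)
have b_lt (i : 'I_m.+1) : pfst x i + psnd x i < n.+2.
  have := ltn_ord (pfst x i); have := ltn_ord (psnd x i); lia.
have b_mono : {homo (fun i : 'I_m.+1 => Ordinal (b_lt i)) : i j / i <= j}.
  by move=> i j ij /=; rewrite leq_add // dhom_mono.
exists (dmk b_mono); rewrite [LHS]surjective_pairing /=; congr pair.
  apply: dhom_eq => i; apply: val_inj; have [/= -> _] := shuffleE (dmk b_mono) i kn.
  rewrite dmkE /=; have [x0 x1] := xk i; have [e|e] := ord2E (psnd x i).
    by have := x0 e; rewrite e addn0 => ->.
  by have := x1 e; rewrite e addn1 /= ltnNge => ->.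
apply: dhom_eq => i; apply: val_inj; have [_ /= ->] := shuffleE (dmk b_mono) i kn.
rewrite dmkE /=; have [x0 x1] := xk i; have [e|e] := ord2E (psnd x i).
  by have := x0 e; rewrite e addn0 ltnNge => ->.
by have := x1 e; rewrite e addn1 ltnS => ->.
Qed.

(** The product of the boundary of the simplex with the interval, together with the end 1 of the
    prism. *)
Definition prism_bdry m (x : prism m) : Prop := skips (pfst x) \/ stays true (psnd x).

(** Omit one vertex of the [k]-th shuffle. Omitting [(k,0)] leaves a face of the previous shuffle,
    or of the end 1 if [k = 0]. Omitting any vertex other than [(k,0)] and [(k,1)] makes the first
    projection miss a vertex. Only the face omitting [(k,1)], at position [k+1], is new. *)
Lemma shuffle_horn k m (b : dhom m n.+1) (j : 'I_n.+2) : k <= n -> j = k.+1 :> nat ->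
  in_horn j b <->
  prism_bdry (act b (shuffle k)) \/ exists2 i, i < k & below i (act b (shuffle k)).
Proof.
move=> kn jk; split.
  case/existsP => l /andP[/eqP lj /forallP bl].
  have bl' i : b i != l :> nat := bl i.
  have {}lj : l <> k.+1 :> nat by move=> e; apply: lj; apply: val_inj; rewrite /= jk.
  have l_lt := ltn_ord l.
  case: (ltngtP l k) => [lk|kl|lk].
  - left; left; exists (inord l) => i; rewrite -val_eqE /= inordK; last by lia.
    have [-> _] := shuffleE b i kn; have := bl' i; case: leqP; lia.
  - left; left; exists (inord l.-1) => i; rewrite -val_eqE /= inordK; last by lia.
    have [-> _] := shuffleE b i kn; have := bl' i; case: leqP; lia.
  - case: k => [|k] in kn jk lj lk *.
      left; right => i; have [_ ->] := shuffleE b i kn.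
      by have := bl' i; rewrite lk; lia.
    right; exists k => // i; have [-> ->] := shuffleE b i kn.
    have := bl' i; case: leqP; lia.
(* Outside the horn, [b] hits every vertex except possibly [k+1]; each of the three ways to lie in
   the old part is refuted by one of these hit vertices. *)
move=> bd; apply/existsP; apply: contrapT => no.
have hit (l : 'I_n.+2) : l <> k.+1 :> nat -> exists i, b i = l.
  move=> lk; apply: contrapT => nob; apply: no; exists l; apply/andP; split.
    by apply/eqP => e; apply: lk; rewrite e.
  by apply/forallP => i; apply/eqP => e; apply: nob; exists i.
case: bd => [[[j' bj]|st]|[i0 ik bel]].
- have lt : (if j' <= k then j' : nat else j'.+1) < n.+2.
    by have := ltn_ord j'; case: ifP; lia.
  have [|i bi] := hit (Ordinal lt); first by rewrite /=; case: ifP; lia.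
  have := bj i; rewrite -val_eqE /=; have [/= -> _] := shuffleE b i kn.
  by rewrite bi /=; case: (leqP j' k) => h; rewrite ?h ?eqxx // ltnNge; case: ifP; lia.
- have [//|i bi] := hit ord0.
  by have := st i; have [_ ->] := shuffleE b i kn; rewrite bi.
- have lt : k < n.+2 by lia.
  have [|i bi] := hit (Ordinal lt); first by rewrite /=; lia.
  have := bel i; have [-> ->] := shuffleE b i kn; rewrite bi /= leqnn ltnn.
  by move=> [/(_ erefl)]; lia.
Qed.

Lemma shuffle_inj k m (b b' : dhom m n.+1) : k <= n ->
  act b (shuffle k) = act b' (shuffle k) -> b = b'.
Proof.
move=> kn e; apply: dhom_eq => i; apply: val_inj => /=.
have [] := shuffleE b i kn; have [] := shuffleE b' i kn; rewrite e => -> ->.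
by case: (leqP (b i) k); case: (leqP (b' i) k); lia.
Qed.

(** Take for [k] the largest first coordinate of a vertex over 0, or 0 if no vertex lies over 0. *)
Lemma prism_cover m (x : prism m) : exists2 k, k <= n & below k x.
Proof.
pose P (k : nat) := [exists i, (psnd x i == 0 :> nat) && (pfst x i == k :> nat)].
have Pn k : P k -> k <= n.
  by case/existsP => i /andP[_ /eqP <-]; rewrite -ltnS.
case: (boolP [exists i, psnd x i == 0 :> nat]) => [/existsP[i0 e0]|/existsPn no].
  have ex : exists k, P k by exists (pfst x i0); apply/existsP; exists i0; rewrite e0 /=.
  case: (ex_maxnP ex Pn) => k /[dup] Pk /existsP[i /andP[/eqP i0' /eqP ik]] max.
  exists k; first exact: Pn.
  move=> l; split=> [l0|l1]; first by apply: max; apply/existsP; exists l; rewrite l0 !eqxx.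
  rewrite -ik; apply: dhom_mono; rewrite leqNgt; apply/negP => /ltnW.
  by move=> /(dhom_mono (psnd x)); rewrite l1 i0'.
by exists 0 => // l; split=> // e; have := no l; rewrite e.
Qed.
End Prism.

Definition dvertex n (k : 'I_n.+1) m : dhom m n :=
  dmk (fun (i j : 'I_m.+1) (_ : i <= j) => leqnn k).

(** The shuffles are attached in increasing order of [k], each along its horn with index [k+1].
    These horns are inner except for the final [k = n+1], a last horn whose last edge is the
    interval over the last vertex of the base simplex. *)
Lemma prism_fill n (X Y : sSet) (p : X ~> Y) (v : prism n.+1 ~> Y) G :
    pmap p v G ->
    (forall m (x : prism n.+1 m), pdom G x <-> prism_bdry x) ->
    inner_fibration p ->
    (forall (u : Horn (ord_max : 'I_n.+3) ~> X) w, p ∘ u = w ∘ horn_incl ord_max ->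
      (forall m (c : dhom m 1),
        G m (dvertex ord_max m, c) ((u ∘ last_edge_in_horn n) m c)) ->
      exists h, is_lift (horn_incl ord_max) p u w h) ->
  exists h : prism n.+1 ~> X, p ∘ h = v /\ forall m b x, G m b x -> x = h m b.
Proof.
move=> pG Gdom inner last.
have stage k : k <= n.+2 -> exists G', [/\ pmap p v G',
    forall m b x, G m b x -> G' m b x & forall m (x : prism n.+1 m),
    pdom G' x <-> prism_bdry x \/ exists2 i, i < k & below i x].
  elim: k => [|k IH] kn.
    exists G; split=> // m x; rewrite Gdom; split; [by left|by case=> // [[]]].
  have {IH} [|G1 [pG1 GG1 dom1]] := IH; first exact: ltnW.
  have kn1 : k <= n.+1 by [].
  have [|||G2 [pG2 G12 dom2]] :=
    @pmap_attach X Y p _ v G1 n.+2 (shuffle n.+1 k) (inord k.+1) pG1.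
  - by move=> m b; rewrite dom1 (@shuffle_horn _ k) // inordK.
  - by move=> m b b'; apply: shuffle_inj.
  - move=> u pu uG; case: (ltnP k n.+1) => kn2.
      by apply: inner; [rewrite inordK ?ltnS|].
    have ek : k = n.+1 by apply/eqP; rewrite eqn_leq kn1.
    have eo : inord k.+1 = ord_max :> 'I_n.+3.
      by apply: val_inj; rewrite /= inordK // ek.
    rewrite eo in u pu uG *; apply: last => // m c.
    (* The interval over the last vertex lies over the boundary, because the base has dimension at
       least 1; so the original [G] already determines the last edge of the horn. *)
    have [x Gx] : pdom G ((dvertex ord_max m, c) : prism n.+1 m).
      by apply/Gdom; left; exists ord0 => i; rewrite dmkE.
    have [_ fun1 _] := pG1.
    suff -> : (u ∘ last_edge_in_horn n) m c = x by [].
    apply: fun1 (GG1 _ _ _ Gx).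
    have := uG m (last_edge_in_horn n m c); congr (G1 m _ _).
    have eE i : (dcomp (last_edge n) c) i = n.+1 + c i :> nat.
      by rewrite dcompE dmkE inordK //; have := ltn_ord (c i); lia.
    apply: (etrans (surjective_pairing _)); congr pair; apply: dhom_eq => i; apply: val_inj.
      have [e1 _] := shuffleE (val (last_edge_in_horn n m c)) i kn1.
      apply: (etrans e1).
      by rewrite /= eE dmkE ek /=; have := ord2E (c i); case: ifP; lia.
    have [_ e2] := shuffleE (val (last_edge_in_horn n m c)) i kn1.
    change (psnd (act (val (last_edge_in_horn n m c)) (shuffle n.+1 k)) i = c i :> nat).
    rewrite e2.
    by rewrite /= eE ek; have [->|->] := ord2E (c i); lia.
  exists G2; split=> // [m b x Gx|m x]; first by apply: G12; apply: GG1.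
  rewrite dom2 dom1 -belowP //; split.
    case=> [[|[i ik bi]]|bk]; [by left|right; exists i => //; exact: ltnW|].
    by right; exists k.
  case=> [|[i]]; first by left; left.
  rewrite ltnS leq_eqVlt => /orP[/eqP-> |ik bi]; [by right|left; right; by exists i].
have [//|G' [[Gact Gfun Gover] GG' dom']] := stage n.+2.
have [h hG] : exists h : prism n.+1 ~> X, forall m b, G' m b (h m b).
  apply: graph_map => //.
  by move=> m b; apply/dom'; right; have [k kn bk] := prism_cover b; exists k.
exists h; split; first by apply: smap_eq => m b; apply: Gover.
by move=> m b x /GG' Gx; apply: Gfun Gx (hG _ _).
Qed.

(** * Lifting homotopies *)

Definition bang m : dhom m 0 := dvertex ord0 m.

Section MarkedLifting.
Variables (X Y : sSet) (p : X ~> Y) (mark : (D1 ~> X) -> Prop).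
Hypothesis inner : inner_fibration p.
Hypothesis last_horn :
  forall n (u : Horn (ord_max : 'I_n.+3) ~> X) w, p ∘ u = w ∘ horn_incl ord_max ->
  mark (u ∘ last_edge_in_horn n) -> exists h, is_lift (horn_incl ord_max) p u w h.
Hypothesis path_lift :
  forall (x : Simplex 0 ~> X) (e : D1 ~> Y), p ∘ x = e ∘ vertex ord_max ->
  exists h, is_lift (vertex ord_max) p x e h /\ mark h.

Variables (T : sSet) (P0 : sub T) (u0 : ssub (box_sub P0 true) ~> X)
  (v : sprod T D1 ~> Y).
Hypothesis sq0 : p ∘ u0 = v ∘ box P0 true.

Local Notation graph := (forall n, sprod T D1 n -> X n -> Prop).

(** The lift must send the interval over each vertex of [P] to a marked edge. Marking all edges, or
    just the Cartesian ones, treats right and Cartesian fibrations together. *)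
Definition marked (P : sub T) (G : graph) : Prop :=
  forall t : T 0, P 0 t ->
  forall e : D1 ~> X, (forall m c, G m (act (bang m) t, c) (e m c)) -> mark e.

Definition graph0 : graph := fun n b x => exists2 d, b = box P0 true n d & x = u0 n d.

Hypothesis marked0 : marked P0 graph0.

(** The objects ordered for Zorn's lemma: lifts defined on [P x Delta^1] together with [T x {1}],
    for varying [P] containing [P0], that extend the given one. *)
Record partial := Partial {
  pset : sub T;
  pgraph : graph;
  p_pmap : pmap p v pgraph;
  p_dom : forall m x, pdom (@pgraph) x <-> box_sub pset true m x;
  p_sub : forall m t, P0 m t -> pset m t;
  p_graph : forall m b x, graph0 b x -> @pgraph m b x;
  p_mark : marked pset pgraph
}.

Definition ple (a b : partial) : bool :=
  `[< (forall m t, pset a m t -> pset b m t) /\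
      (forall m z x, @pgraph a m z x -> @pgraph b m z x) >].

Program Definition partial0 : partial := @Partial P0 graph0 _ _ _ _ _.
Next Obligation.
split.
- move=> m n f _ _ [d -> ->]; exists (act f d) => //; exact: esym (sfun_nat _ _ _).
- move=> n b x x' [d -> ->] [d' e ->]; congr (u0 n _); exact: sub_incl_inj e.
- move=> n _ _ [d -> ->]; exact: (smap_congr d sq0).
Qed.
Next Obligation.
move=> m x; split; first by move=> [_ [[y yP] -> _]].
by move=> xP; exists (u0 m (exist _ x xP)), (exist _ x xP).
Qed.
Next Obligation. by []. Qed.
Next Obligation. by []. Qed.
Next Obligation. exact: marked0. Qed.

Lemma partial_chain (A : set partial) : total_on A ple -> exists t, forall s, A s -> ple s t.
Proof.
move=> totA.
(* Adding [partial0] makes the union contain the given lift even when the chain is empty. *)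
pose B (a : partial) := A a \/ a = partial0.
have le0 a : ple partial0 a by apply/asboolP; split; [exact: p_sub|exact: p_graph].
have refl a : ple a a by apply/asboolP.
have totB a b : B a -> B b -> ple a b \/ ple b a.
  by move=> [Aa|->] [Ab|->]; [exact: totA|right|left|left].
have common a b : B a -> B b -> exists2 c, B c & ple a c /\ ple b c.
  by move=> Ba Bb; have [ab|ba] := totB _ _ Ba Bb; [exists b|exists a].
pose U := @Sub T (fun n t => exists2 a, B a & pset a n t)
  (fun m n f t '(ex_intro2 a Ba at_) => ex_intro2 _ _ a Ba (sub_act f at_)).
pose G : graph := fun n b x => exists2 a, B a & @pgraph a n b x.
have pG : pmap p v G.
  split.
  - move=> m n f b x [a Ba Gx]; exists a => //.
    by have [act_ _ _] := p_pmap a; apply: act_.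
  - move=> n b x x' [a Ba Gx] [a' Ba' Gx'].
    have [c Bc [/asboolP[_ ac] /asboolP[_ ac']]] := common _ _ Ba Ba'.
    by have [_ fun_ _] := p_pmap c; apply: fun_ (ac _ _ _ Gx) (ac' _ _ _ Gx').
  - by move=> n b x [a Ba Gx]; have [_ _ over] := p_pmap a; apply: over.
have domG m x : pdom G x <-> box_sub U true m x.
  split.
    move=> [y [a Ba Gy]]; have /p_dom [Pt|st] : pdom (@pgraph a) x by exists y.
      by left; exists a.
    by right.
  move=> [[a Ba Pt]|st].
    by have [|y Gy] := (p_dom a x).2; [left|exists y; exists a].
  have [|y Gy] := (p_dom partial0 x).2; first by right.
  by exists y; exists partial0 => //; right.
have subU m t : P0 m t -> U m t by move=> Pt; exists partial0 => //; right.
have subG m b x : graph0 b x -> G m b x by move=> Gx; exists partial0 => //; right.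
have markG : marked U G.
  move=> t [a Ba Pt] e eG; apply: (p_mark Pt) => m c.
  have [|y Gy] := (p_dom a ((act (bang m) t, c) : sprod T D1 m)).2.
    by left; apply: sub_act.
  have [_ fun_ _] := pG.
  by rewrite (fun_ m (act (bang m) t, c) (e m c) y) //; exists a.
exists (Partial pG domG subU subG markG) => a Aa; apply/asboolP; split.
  by move=> m t Pt; exists a => //; left.
by move=> m z x Gx; exists a => //; left.
Qed.

Section Extend.
Variables (a : partial) (n : nat) (t : T n).
Hypothesis not_t : ~ pset a n t.
Hypothesis bdry_t : forall m (b : dhom m n), skips b -> pset a m (act b t).

Program Definition cell_prism : prism n ~> sprod T D1 :=
  @SMap (prism n) (sprod T D1) (fun m x => (act (pfst x) t, x.2)) _.
Next Obligation. by move=> m k f [x c] /=; rewrite /pfst -act_comp. Qed.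

Definition cell_graph m (x : prism n m) (y : X m) : Prop :=
  prism_bdry x /\ pgraph a (cell_prism m x) y.

Lemma cell_bdry m (x : prism n m) :
  prism_bdry x <-> box_sub (pset a) true m (cell_prism m x).
Proof.
split=> [[sk|st]|[Pt|st]]; [by left; apply: bdry_t|by right| |by right].
by left; apply: nonmember_skips Pt.
Qed.

Lemma cell_graph_pmap : pmap p (v ∘ cell_prism) cell_graph.
Proof.
have [act_ fun_ over_] := p_pmap a; split.
- move=> m k f x y [bx Gy]; split; last by rewrite sfun_nat; apply: act_.
  by rewrite cell_bdry sfun_nat; apply: sub_act; apply/cell_bdry.
- by move=> m x y y' [_ Gy] [_ Gy']; apply: fun_ Gy Gy'.
- by move=> m x y [_ Gy]; apply: over_.
Qed.

Lemma cell_graph_dom m (x : prism n m) : pdom cell_graph x <-> prism_bdry x.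
Proof.
split=> [[y []]//|bx]; have [|y Gy] := (p_dom a (cell_prism m x)).2.
  exact/cell_bdry.
by exists y.
Qed.

(** Away from its boundary the prism over [t] embeds in [T x Delta^1], so a filler [h] compatible
    with the old values can be glued on. The marking needs attention only when [t] is itself a
    vertex. *)
Lemma partial_extend (h : prism n ~> X) :
    p ∘ h = v ∘ cell_prism -> (forall m x y, @cell_graph m x y -> y = h m x) ->
    (n = 0 -> forall e : D1 ~> X,
      (forall m c, e m c = h m (dvertex ord0 m, c)) -> mark e) ->
  exists2 a', ple a a' & pset a' n t.
Proof.
move=> ph hG hmark; have [Gact Gfun Gover] := p_pmap a.
pose P' := @Sub T (fun m s => pset a m s \/ exists b : dhom m n, s = act b t)
  (fun m k f s Ps => match Ps with
    | or_introl P => or_introl (sub_act f P)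
    | or_intror (ex_intro b e) => or_intror (ex_intro _ (dcomp b f)
        (etrans (f_equal (act f) e) (esym (act_comp b f t)))) end).
pose G' := glue (@pgraph a) cell_prism h.
have hG' m (x : prism n m) y : pgraph a (cell_prism m x) y -> y = h m x.
  move=> Gy; apply: hG; split=> //; apply/cell_bdry/p_dom.
  by exists y.
have pG' : pmap p v G'.
  apply: pmap_glue => // m x x' e.
  have [bx|nbx] := pselect (prism_bdry x).
    have /cell_graph_dom [y [_ Gy]] := bx.
    rewrite -(hG' _ _ _ Gy); apply: hG'; by rewrite -e.
  have nbx' : ~ prism_bdry x'.
    by move=> /cell_bdry; rewrite -e => /cell_bdry.
  (* Two points outside the boundary with equal image coincide, since a nonmember with boundary in
     the subobject is hit injectively by surjections. *)
  case: x x' e nbx nbx' => [b c] [b' c'] [e1 e2] nbx nbx'; congr (h m _).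
  congr pair => //; apply: (@nonmember_inj _ _ _ _ not_t bdry_t) => // sk.
    by apply: nbx; left.
  by apply: nbx'; left.
have domG' m x : pdom G' x <-> box_sub P' true m x.
  split.
    move=> [y [Gy|[k [-> _]]]].
      have /p_dom [Px|st] : pdom (@pgraph a) x by exists y.
        by left; left.
      by right.
    by left; right; exists (pfst k).
  have dom1 : box_sub (pset a) true m x -> pdom G' x.
    by move=> /p_dom [y Gy]; exists y; left.
  move=> [[Pt|[b e]]|st]; [by apply: dom1; left| |by apply: dom1; right].
  exists (h m (b, x.2)); right; exists (b, x.2); split=> //.
  by rewrite /= -e -surjective_pairing.
have sub' m s : P0 m s -> P' m s by move=> /p_sub; left.
have graph' m b x : graph0 b x -> G' m b x by move=> /p_graph; left.
have mark' : marked P' G'.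
  move=> s Ps e eG; have [Pas|nPas] := pselect (pset a 0 s).
    apply: (p_mark Pas) => m c.
    have [|y Gy] := (p_dom a ((act (bang m) s, c) : sprod T D1 m)).2.
      by left; apply: sub_act.
    have [_ fun_ _] := pG'.
    by rewrite (fun_ m (act (bang m) s, c) (e m c) y) //; left.
  case: Ps => [//|[b sb]].
  (* If [n > 0], any vertex of the [n]-simplex misses either vertex 0 or vertex [n], so it lies in
     the boundary and was in the domain before. *)
  have n0 : n = 0.
    apply: contrapT => n0; apply: nPas; rewrite sb; apply: bdry_t.
    have [/(congr1 val) /= e0|ne] := pselect (b ord0 = ord0).
      exists ord_max => i; rewrite !ord1 -val_eqE /= e0.
      by apply/eqP => e1; apply: n0.
    by exists ord0 => i; rewrite ord1; apply/eqP.
  apply: hmark => // m c; have [_ fun_ _] := pG'.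
  apply: fun_ (eG m c) _; right; exists (dvertex ord0 m, c); split=> //=.
  congr pair; rewrite sb -act_comp; congr (act _ t); apply: dhom_eq => i.
  apply: val_inj; rewrite dcompE /= dmkE /=.
  by rewrite dmkE /=; have := ltn_ord (b ord0); lia.
exists (Partial pG' domG' sub' graph' mark').
  by apply/asboolP; split=> /= *; left.
by right; exists (did n); rewrite act_id.
Qed.

End Extend.

(** The last edge of the only non-inner horn lies over the last vertex of [t], which is already in
    the domain; hence it is marked and the horn can be filled. *)
Lemma cell_fillS (a : partial) n (t : T n.+1) :
    ~ pset a n.+1 t ->
    (forall m (b : dhom m n.+1), skips b -> pset a m (act b t)) ->
  exists h : prism n.+1 ~> X, p ∘ h = v ∘ cell_prism t /\
    forall m x y, @cell_graph a n.+1 t m x y -> y = h m x.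
Proof.
move=> not_t bdry_t; apply: prism_fill => //.
- exact: cell_graph_pmap.
- exact: cell_graph_dom.
move=> u w uw uG; apply: last_horn => //.
have Pl : pset a 0 (act (dvertex ord_max 0) t).
  by apply: bdry_t; exists ord0 => i; rewrite dmkE.
apply: (p_mark Pl) => m c; have [_ Gc] := uG m c.
rewrite -act_comp; suff -> : dcomp (dvertex ord_max 0) (bang m) =
  dvertex (ord_max : 'I_n.+2) m by [].
by apply: dhom_eq => i; rewrite dcompE !dmkE.
Qed.

(** Over a vertex the prism is one edge with prescribed end 1, and [path_lift] supplies a marked
    lift of it. *)
Lemma cell_fill0 (a : partial) (t : T 0) :
  exists h : prism 0 ~> X, [/\ p ∘ h = v ∘ cell_prism t,
    forall m x y, @cell_graph a 0 t m x y -> y = h m x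
    & forall e : D1 ~> X, (forall m c, e m c = h m (dvertex ord0 m, c)) -> mark e].
Proof.
have [Gact Gfun Gover] := p_pmap a.
have [|x0 Gx0] := (p_dom a ((t, dconst 0 true) : sprod T D1 0)).2.
  by right; apply: stays_dconst.
pose e : D1 ~> Y := v ∘ cell_prism t ∘ spair
  (@SMap D1 (Simplex 0) (fun m _ => bang m) (fun _ _ _ _ => to0_eq _ _)) (idm D1).
have [|g [[g1 g2] mg]] := @path_lift (yo x0) e.
  apply: smap_eq => m b; rewrite !smap_compE yoE sfun_nat (Gover _ _ _ Gx0).
  rewrite -sfun_nat; congr (v m _); congr pair => /=.
    by congr (act _ t); apply: to0_eq.
  apply: dhom_eq => i; rewrite !dcompE !dmkE; apply: val_inj; rewrite /= inordK //.
exists (g ∘ spr2 (Simplex 0) D1); split.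
- rewrite comp_assoc g2; apply: smap_eq => m [b c]; rewrite !smap_compE.
  by congr (v m _); congr pair; congr (act _ t); apply: to0_eq.
- move=> m [b c] y [bd Gy]; case: bd => [[j /(_ ord0)]|st].
    by rewrite !ord1.
  have cE : c = dconst m true := staysE st; rewrite /= cE in Gy *.
  have -> : y = act (bang m) x0.
    apply: Gfun Gy _; have := Gact _ _ (bang m) _ _ Gx0; rewrite /= dconst_act.
    by have -> : b = bang m by apply: to0_eq.
  rewrite -[act _ x0]/(yo x0 m (bang m)) -g1 /=; congr (g m _).
  apply: dhom_eq => i; apply: val_inj; rewrite dcompE dmkE; exact: (esym (dconstE true i)).
- move=> e' ee'; suff -> : e' = g by []; exact: smap_eq.
Qed.

Lemma marked_box_lifting : exists h, is_lift (box P0 true) p u0 v h.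
Proof.
have [a amax] : exists a, premaximal ple a.
  apply: (ZL_preorder partial0) partial_chain.
  - by move=> a; apply/asboolP.
  - move=> b a c /asboolP[ab ab'] /asboolP[bc bc']; apply/asboolP.
    by split=> [m t /ab/bc|m z x /ab'/bc'].
have [Gact Gfun Gover] := p_pmap a.
have full n (t : T n) : pset a n t.
  apply: contrapT => not_t.
  (* A missing simplex of least dimension has its whole boundary in the domain, so the lift extends
     over it and contradicts maximality. *)
  have ex : exists k, `[< exists s : T k, ~ pset a k s >].
    by exists n; apply/asboolP; exists t.
  case: (ex_minnP ex) => k /asboolP[s not_s] kmin {n t not_t ex}.
  have [] : exists2 a', ple a a' & pset a' k s; last first.
    by move=> a' /[dup] /amax /asboolP[sub' _] _ /sub'.
  case: k s not_s kmin => [|k] s not_s kmin.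
    have bd : forall m (b : dhom m 0), skips b -> pset a m (act b s).
      by move=> m b [j /(_ ord0)]; rewrite !ord1.
    have [h [h1 h2 h3]] := cell_fill0 a s.
    exact: (@partial_extend a 0 s not_s bd h).
  have bd : forall m (b : dhom m k.+1), skips b -> pset a m (act b s).
    move=> m b /skips_factor[d [b' [_ ->]]]; rewrite act_comp; apply: sub_act.
    apply: contrapT => not_d; suff : k.+1 <= k by rewrite ltnn.
    by apply: kmin; apply/asboolP; exists (act d s).
  have [h [h1 h2]] := cell_fillS not_s bd.
  exact: (@partial_extend a k.+1 s not_s bd h).
have [h hG] : exists h : sprod T D1 ~> X, forall m b, @pgraph a m b (h m b).
  by apply: graph_map => // m b; apply/p_dom; left.
exists h; split; apply: smap_eq => m b.
  by apply: Gfun (hG _ _) _; apply: p_graph; exists b.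
exact: Gover.
Qed.

End MarkedLifting.

(** * Right, left, Cartesian and coCartesian fibrations *)

Lemma right_fibration_efib (X Y : sSet) (p : X ~> Y) :
  right_fibration p -> efib true p.
Proof.
move=> rf T P u v uv.
apply: (marked_box_lifting (mark := fun _ => True)) => //.
- by move=> n k /andP[k0 kn]; apply: rf; [exact: leq_ltn_trans kn|rewrite k0 ltnW].
- by move=> n u' w uw _; exact: (rf n.+2 ord_max isT (leqnn n.+2)).
(* The vertex 1 of the interval is isomorphic to the horn of the 1-simplex with index 1, against
   which a right fibration lifts. *)
move=> x e xe; have [|h xh] := @has_lifting_retract _ _ _ _ _ X Y (vertex ord_max)
    (@horn_incl 1 ord_max) p _ (rf 1 ord_max isT isT) x e xe; last by exists h.
have hornP m (c : dhom m 1) : in_horn ord_max c -> c = dconst m true.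
  case/existsP => j /andP[j1 /forallP cj]; apply: staysE => i /=.
  have := cj i; move: j1; rewrite -!val_eqE /=.
  by have := ord2E j; have := ord2E (c i); lia.
have vertexE m (a : dhom m 0) : vertex ord_max m a = dconst m true.
  by apply: staysE => i /=; rewrite dcompE dmkE.
have const_horn m : in_horn (ord_max : 'I_2) (dconst m true).
  apply/existsP; exists ord0; apply/andP; split=> //; apply/forallP => i.
  by rewrite -val_eqE /= dconstE.
have natS m n (f : dhom m n) :
    exist (fun c => in_horn ord_max c) (dconst m true) (const_horn m) =
    act f (exist _ (dconst n true) (const_horn n) : Horn (ord_max : 'I_2) n).
  by apply: val_inj; rewrite /= dconst_act.
exists (@SMap (Simplex 0) (Horn (ord_max : 'I_2)) _ (fun m n f _ => natS m n f)).
exists (@SMap (Horn (ord_max : 'I_2)) (Simplex 0) (fun m _ => bang m)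
   (fun _ _ _ _ => to0_eq _ _)).
exists (idm _), (idm _); split.
- by apply: smap_eq => m a; apply: to0_eq.
- by rewrite comp_idl.
- by rewrite comp_idl; apply: smap_eq => m a; rewrite vertexE.
- by rewrite comp_idl; apply: smap_eq => m [c hc]; rewrite smap_compE vertexE -(hornP m c hc).
Qed.

Lemma cartesian_path_lifting (X Y : sSet) (p : X ~> Y) :
  cartesian_fibration p -> path_lifting true p.
Proof.
move=> [inner path] T u v uv.
apply: (marked_box_lifting (mark := cartesian_edge p)) => //.
by move=> n u' w uw; apply.
Qed.

Section HornDeformation.
Variables (e : bool) (n : nat) (k : 'I_n.+1).

Definition push (x : 'I_n.+1) : 'I_n.+1 :=
  if e then (if x <= k then k else x) else (if k <= x then k else x).

Lemma pushE x : push x = (if e then maxn k x else minn k x) :> nat.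
Proof. by rewrite /push; case: e; case: leqP => /=; lia. Qed.

Lemma horn_push_subproof m (a : dhom m n) (c : dhom m 1) :
  {homo (fun i => if c i == e :> nat then push (a i) else a i) : i j / i <= j}.
Proof.
move=> i j ij; have := dhom_mono a ij; have := dhom_mono c ij.
have := ord2E (c i); have := ord2E (c j).
rewrite 2!(fun_if (@nat_of_ord _)) !pushE.
by case: e; case: eqP; case: eqP => /=; lia.
Qed.

Program Definition horn_push : sprod (Simplex n) D1 ~> Simplex n :=
  @SMap (sprod (Simplex n) D1) (Simplex n)
    (fun m x => dmk (@horn_push_subproof m x.1 x.2)) _.
Next Obligation.
by move=> l m f [a c]; apply: dhom_eq => i; rewrite dcompE !dmkE.
Qed.

(** The homotopy from the identity to [push] preserves every face opposite a vertex other than [k],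
    hence the horn. At its end [e] it lands in the face opposite 0 or [n], which belongs to the horn
    because [k] differs from that vertex. *)
Lemma horn_anodyne : 0 < n -> (if e then 0 < k else k < n) ->
  eanodyne e (horn_incl k).
Proof.
move=> n0 hk X Y q Fq; apply: has_lifting_inj.
  by move=> m x y xy; apply: val_inj.
have imE m (a : dhom m n) : im_sub (horn_incl k) m a <-> in_horn k a.
  by split=> [[x ->]|ha]; [apply: (valP x)|exists (exist _ a ha)].
suff: eanodyne e (sub_incl (im_sub (horn_incl k))) by apply.
apply: (deformation_anodyne (r := horn_push)) => m a.
  apply: dhom_eq => i; rewrite dmkE dconstE /=.
  by case: e.
move=> c; rewrite !imE => -[/existsP[j /andP[jk /forallP aj]]|st].
  apply/existsP; exists j; rewrite jk; apply/forallP => i; rewrite dmkE /= /push.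
  by repeat case: ifP => // _; rewrite ?aj // eq_sym.
apply/existsP; exists (if e then ord0 else ord_max); apply/andP; split.
  by move: hk; case: e => hk; rewrite -val_eqE /=; lia.
apply/forallP => i; rewrite dmkE /= st eqxx -val_eqE /= pushE.
by have := ltn_ord ((a : dhom m n) i); move: hk; case: e => hk /=; lia.
Qed.
End HornDeformation.

Lemma right_fibrationE (X Y : sSet) (p : X ~> Y) : right_fibration p <-> efib true p.
Proof.
split=> [|Fp n k n0 /andP[k0 _]]; first exact: right_fibration_efib.
exact: (@horn_anodyne true).
Qed.

Lemma dopK m n (a : dhom m n) : dop (dop a) = a.
Proof. by apply: dhom_eq => i; rewrite !dmkE !rev_ordK. Qed.

Definition unop (A X : sSet) (f : sop A ~> sop X) : A ~> X.
refine (@SMap A X (fun n => f n) _).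
by move=> m n a x; have := sfun_nat f (dop a) x; rewrite /= dopK.
Defined.

Lemma has_lifting_op (A B X Y : sSet) (i : A ~> B) (p : X ~> Y) :
  has_lifting (sop_map i) (sop_map p) <-> has_lifting i p.
Proof.
split=> lp u v uv.
  have [|h [h1 h2]] := lp (sop_map u) (sop_map v).
    by apply: smap_eq => n x; exact: (smap_congr (x : A n) uv).
  exists (unop h); split; apply: smap_eq => n x.
    exact: (smap_congr (x : sop A n) h1).
  exact: (smap_congr (x : sop B n) h2).
have [|h [h1 h2]] := lp (unop u) (unop v).
  by apply: smap_eq => n x; exact: (smap_congr (x : sop A n) uv).
exists (sop_map h); split; apply: smap_eq => n x.
  exact: (smap_congr (x : A n) h1).
exact: (smap_congr (x : B n) h2).
Qed.

(** Reversing vertices identifies the horn [k] with the opposite of the horn [rev_ord k]. *)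
Lemma left_fibration_op (X Y : sSet) (p : X ~> Y) :
  left_fibration p -> right_fibration (sop_map p).
Proof.
move=> lf n k n0 /andP[k0 kn].
have hornop (j : 'I_n.+1) m (a : dhom m n) : in_horn j a -> in_horn (rev_ord j) (dop a).
  case/existsP => l /andP[lj /forallP al]; apply/existsP; exists (rev_ord l).
  rewrite (inj_eq rev_ord_inj) lj; apply/forallP => i.
  by rewrite dmkE (inj_eq rev_ord_inj).
have hornop' m (a : dhom m n) : in_horn (rev_ord k) a -> in_horn k (dop a).
  by move=> /hornop; rewrite rev_ordK.
apply: (@has_lifting_retract _ _ _ _ _ _ _ _ (sop_map (horn_incl (rev_ord k)))); last first.
  by apply/has_lifting_op; apply: lf => //=; have := ltn_ord k; lia.
have nat1 l m (f : dhom l m) (a : Horn k m) :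
    exist (fun b => in_horn (rev_ord k) b) (dop (val (act f a))) (hornop k l _ (valP (act f a))) =
    act f (exist _ (dop (val a)) (hornop k m _ (valP a)) : sop (Horn (rev_ord k)) m).
  by apply: val_inj; rewrite /= dop_comp.
exists (@SMap (Horn k) (sop (Horn (rev_ord k))) _ nat1).
have nat2 l m (f : dhom l m) (a : sop (Horn (rev_ord k)) m) :
    exist (fun b => in_horn k b) (dop (val (act f a))) (hornop' l _ (valP (act f a))) =
    act f (exist _ (dop (val a)) (hornop' m _ (valP a)) : Horn k m).
  by apply: val_inj; rewrite /= dop_comp dopK.
exists (@SMap (sop (Horn (rev_ord k))) (Horn k) _ nat2).
exists (@SMap (Simplex n) (sop (Simplex n)) (fun m a => dop a)
   (fun l m f a => dop_comp a f)).
have nat3 l m (f : dhom l m) (a : sop (Simplex n) m) : dop (act f a) = act f (dop a : Simplex n m).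
  by rewrite /= dop_comp dopK.
exists (@SMap (sop (Simplex n)) (Simplex n) (fun m a => dop a) nat3).
split.
- by apply: smap_eq => m a; apply: val_inj; rewrite /= dopK.
- by apply: smap_eq => m a; rewrite /= dopK.
- exact: smap_eq.
- exact: smap_eq.
Qed.

(** Reversing the interval factor exchanges its ends, so the opposite of a box at [false] is a box
    at [true] over the opposite of [T]. *)
Lemma box_op (T : sSet) (P : sub T) (X Y : sSet) (p : X ~> Y)
    (P' : sub (sop T)) : (forall n t, P n t <-> P' n t) ->
  has_lifting (box P' true) (sop_map p) -> has_lifting (box P false) p.
Proof.
move=> PP' lp; apply/has_lifting_op; apply: has_lifting_retract lp.
have stays_op e m (c : dhom m 1) : stays e c -> stays (~~ e) (dop c).
  by move=> ce i; rewrite dmkE /= ce; case: (e).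
have natS l m (f : dhom l m) (x : sop (sprod T D1) m) :
    ((act f x).1, dop (act f x).2) = act f ((x.1, dop x.2) : sprod (sop T) D1 m).
  by rewrite /= dop_comp dopK.
have natR l m (f : dhom l m) (x : sprod (sop T) D1 m) :
    ((act f x).1, dop (act f x).2) = act f ((x.1, dop x.2) : sop (sprod T D1) m).
  by rewrite /= dop_comp.
pose S := @SMap (sop (sprod T D1)) (sprod (sop T) D1) _ natS.
pose R := @SMap (sprod (sop T) D1) (sop (sprod T D1)) _ natR.
have SP m (x : sop (ssub (box_sub P false)) m) :
    box_sub P' true m (S m (proj1_sig x)).
  by case: x => [[t c] [Pt|st]]; [left; apply/PP'|right; exact: stays_op st].
have RP m (x : ssub (box_sub P' true) m) :
    box_sub P false m (R m (proj1_sig x)).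
  by case: x => [[t c] [Pt|st]]; [left; apply/PP'|right; exact: stays_op st].
have natS' l m (f : dhom l m) (x : sop (ssub (box_sub P false)) m) :
    exist (box_sub P' true l) _ (SP l (act f x)) =
    act f (exist _ _ (SP m x) : ssub (box_sub P' true) m).
  by apply: eq_exist; rewrite /= dop_comp dopK.
have natR' l m (f : dhom l m) (x : ssub (box_sub P' true) m) :
    exist (box_sub P false l) _ (RP l (act f x)) =
    act f (exist _ _ (RP m x) : sop (ssub (box_sub P false)) m).
  by apply: eq_exist; rewrite /= dop_comp.
exists (@SMap (sop (ssub (box_sub P false))) (ssub (box_sub P' true)) _ natS').
exists (@SMap (ssub (box_sub P' true)) (sop (ssub (box_sub P false))) _ natR').
exists S, R; split.
- by apply: smap_eq => m [[t c] h]; apply: eq_exist; rewrite /= dopK.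
- by apply: smap_eq => m [t c]; rewrite /= dopK.
- exact: smap_eq.
- exact: smap_eq.
Qed.

Lemma left_fibrationE (X Y : sSet) (p : X ~> Y) : left_fibration p <-> efib false p.
Proof.
split=> [/left_fibration_op/right_fibration_efib rf T P|Fp n k n0 /andP[_ kn]].
  pose P' := @Sub (sop T) (fun n t => P n t) (fun m n f t => @sub_act T P m n (dop f) t).
  exact: (box_op (P' := P')) (rf _ _).
exact: (@horn_anodyne false).
Qed.

Lemma cocartesian_path_lifting (X Y : sSet) (p : X ~> Y) :
  cocartesian_fibration p -> path_lifting false p.
Proof.
by move=> /cartesian_path_lifting pl T; apply: (box_op (P' := sub0 (sop T))) (pl _).
Qed.

(** * Pulling back anodyne maps *)

Lemma end_vertexE e : end_vertex e = e :> nat.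
Proof. by rewrite inordK //; case: e. Qed.

Lemma toward_subproof (e : bool) m (c c' : dhom m 1) :
  {homo (fun i => if c' i == e :> nat then end_vertex e else c i) : i j / i <= j}.
Proof.
move=> i j ij; have := dhom_mono c ij; have := dhom_mono c' ij.
have := ord2E (c i); have := ord2E (c j); have := ord2E (c' i); have := ord2E (c' j).
rewrite 2!(fun_if (@nat_of_ord _)) !end_vertexE.
by case: e; case: eqP; case: eqP => /=; lia.
Qed.

(** The pointwise maximum for [e = true] and minimum for [e = false]: the contraction of the
    interval onto its end [e], with [c'] as time. *)
Definition toward_dhom (e : bool) m (c c' : dhom m 1) : dhom m 1 := dmk (@toward_subproof e m c c').

Lemma toward_dhomE (e : bool) m (c c' : dhom m 1) i :
  toward_dhom e c c' i = (if c' i == e :> nat then e : nat else c i) :> nat.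
Proof. by rewrite dmkE (fun_if (@nat_of_ord _)) end_vertexE. Qed.

Program Definition toward (e : bool) (T : sSet) :
    sprod (sprod T D1) D1 ~> sprod T D1 :=
  @SMap (sprod (sprod T D1) D1) (sprod T D1)
    (fun m x => (x.1.1, toward_dhom e x.1.2 x.2)) _.
Next Obligation.
move=> e T m n f [[t c] c']; congr pair; apply: dhom_eq => i; apply: val_inj.
by rewrite dcompE [LHS]toward_dhomE [RHS]toward_dhomE /= !dcompE.
Qed.

Lemma toward_away e m (c : dhom m 1) : toward_dhom e c (dconst m (~~ e)) = c.
Proof.
apply: dhom_eq => i; apply: val_inj; rewrite [LHS]toward_dhomE dconstE.
by case: e.
Qed.

Lemma toward_stays e m (c c' : dhom m 1) :
  stays e c \/ stays e c' -> stays e (toward_dhom e c c').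
Proof.
by move=> st i; rewrite toward_dhomE; case: st => ->; [case: eqP|rewrite eqxx].
Qed.

Section DependentProduct.
Variables (e : bool) (Z W R Z' : sSet) (p : Z ~> W) (q : R ~> Z') (v : Z ~> Z').

Local Notation family n := (forall m, dhom m n -> Z m -> R m -> Prop).

(** A section is recorded by its graph, so that equality of families reduces to propositional
    extensionality, with no transport between fibres. *)
Record is_family n (w : W n) (F : family n) : Prop := IsFamily {
  fam_over : forall m (a : dhom m n) z r, F m a z r -> p m z = act a w /\ q m r = v m z;
  fam_ex : forall m (a : dhom m n) z, p m z = act a w -> exists r, F m a z r;
  fam_uniq : forall m (a : dhom m n) z r r', F m a z r -> F m a z r' -> r = r';
  fam_act : forall l m (f : dhom l m) (a : dhom m n) z r,
    F m a z r -> F l (dcomp a f) (act f z) (act f r)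
}.

Definition dprod_cell n := {x : W n * family n | is_family x.1 x.2}.

Program Definition dprod_act m n (f : dhom m n) (x : dprod_cell n) : dprod_cell m :=
  exist _ (act f (proj1_sig x).1, fun l a z r => (proj1_sig x).2 l (dcomp f a) z r) _.
Next Obligation.
move=> m n f [[w F] [o x u a]]; split=> /=.
- by move=> l b z r /o; rewrite act_comp.
- by move=> l b z zE; apply: x; rewrite act_comp.
- by move=> l b z r r'; apply: u.
- by move=> k l g b z r /(a _ _ g); rewrite dcompA.
Qed.

(** One inclusion suffices, since both families are graphs of functions on the same domain. *)
Lemma dprod_eq n (x y : dprod_cell n) : (proj1_sig x).1 = (proj1_sig y).1 ->
  (forall m a z r, (proj1_sig x).2 m a z r -> (proj1_sig y).2 m a z r) -> x = y.
Proof.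
case: x y => [[w F] Fx] [[w' F'] Fy] /= ew FF'; subst w'.
apply: eq_exist; congr pair.
apply: functional_extensionality_dep => m; apply/funext => a; apply/funext => z.
apply/funext => r; apply/propext; split; first exact: FF'.
move=> F'r; have [pz _] := fam_over Fy F'r; have [r' Fr'] := fam_ex Fx pz.
by rewrite (fam_uniq Fy F'r (FF' _ _ _ _ Fr')).
Qed.

(** The dependent product of [R -> Z'], pulled back to [Z], along [p : Z -> W]:
    a simplex over [w] is a section of [R] over the fibre of [p] over [w]. *)
Program Definition dprod : sSet := @SSet dprod_cell dprod_act _ _.
Next Obligation.
move=> n x; apply: dprod_eq => [|m a z r] /=; first by rewrite act_id.
by rewrite dcomp_idl.
Qed.
Next Obligation.
move=> l m n g f x; apply: dprod_eq => [|k a z r] /=; first by rewrite act_comp.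
by rewrite dcompA.
Qed.

Definition dprod_map : dprod ~> W :=
  @SMap dprod W (fun _ x => (proj1_sig x).1) (fun _ _ _ _ => erefl).

Definition fam n (x : dprod n) : family n := (proj1_sig x).2.

Lemma famP n (x : dprod n) : is_family (dprod_map n x) (fam x).
Proof. exact: (proj2_sig x). Qed.

(** Transposition for the adjunction between pullback along [p] and dependent product. *)
Lemma dprod_smap (T : sSet) (w : T ~> W) (h : pb w p ~> R) : q ∘ h = v ∘ pb2 w p ->
  exists k : T ~> dprod, dprod_map ∘ k = w /\
    forall n (x : pb w p n), fam (k n (pb1 w p n x)) (did n) (pb2 w p n x) (h n x).
Proof.
move=> qh.
pose F n (t : T n) m (a : dhom m n) z r :=
  exists2 x : pb w p m, pb1 w p m x = act a t & pb2 w p m x = z /\ r = h m x.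
have FP n (t : T n) : is_family (w n t) (F n t).
  split.
  - move=> m a z r [x xt [<- ->]]; split; last exact: (smap_congr x qh).
    by rewrite -pb_sqE xt sfun_nat.
  - move=> m a z pz; have [|x [x1 x2]] := @pb_ex _ _ _ w p m (act a t) z.
      by rewrite sfun_nat pz.
    by exists (h m x); exists x.
  - move=> m a z r r' [x x1 [x2 ->]] [y y1 [y2 ->]]; congr (h m _).
    by apply: pb_eq; rewrite ?x1 ?x2 ?y1 ?y2.
  - move=> l m f a z r [x x1 [x2 ->]]; exists (act f x); first by rewrite sfun_nat x1 act_comp.
    by rewrite !sfun_nat x2.
have knat m n (f : dhom m n) (t : T n) :
   exist (fun x : W m * family m => is_family x.1 x.2)
     (w m (act f t), F m (act f t)) (FP m (act f t)) =
   act f (exist _ (w n t, F n t) (FP n t) : dprod n).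
  apply: dprod_eq => [|l a z r] /=; first by rewrite sfun_nat.
  by move=> [x x1 x2]; exists x => //; rewrite act_comp.
exists (@SMap T dprod _ knat); split; first exact: smap_eq.
by move=> n x; exists x => //; rewrite act_id.
Qed.

Lemma fam_did n (x : dprod n) m (a : dhom m n) z r :
  fam (act a x) (did m) z r <-> fam x a z r.
Proof. by rewrite /fam /= dcomp_idr. Qed.

(** By transposition, a box problem against the dependent product becomes a lifting problem of the
    preimage [E] of the box, inside the pullback [B], against [q]. It remains to see that the
    inclusion of [E] is anodyne. *)
Lemma dprod_efib : path_lifting (~~ e) p -> efib e q -> efib e dprod_map.
Proof.
move=> pl Fq T P u w uw.
pose B := pb w p; pose E := preim_sub (pb1 w p) (box_sub P e).
have anE : eanodyne e (sub_incl E).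
  (* [H] lifts along [p] the push of [T x Delta^1] toward [e]. The push is the identity at the end
     [~~ e], where the lift is prescribed to be the projection; this is why [path_lifting] is needed
     at that end. *)
  have [H [H1 H2]] : exists H : sprod B D1 ~> Z,
      (forall n b, H n (b, dconst n (~~ e)) = pb2 w p n b) /\
      p ∘ H = w ∘ toward e T ∘ spair (pb1 w p ∘ spr1 B D1) (spr2 B D1).
    pose s := @SMap (ssub (box_sub (sub0 B) (~~ e))) Z
      (fun n x => pb2 w p n (proj1_sig x).1) (fun m n f x => sfun_nat (pb2 w p) f (proj1_sig x).1).
    have [|H [H1 H2]] :=
        pl B s (w ∘ toward e T ∘ spair (pb1 w p ∘ spr1 B D1) (spr2 B D1)).
      apply: smap_eq => n [[b c] [[]|st]]; rewrite !smap_compE /=.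
      apply: (etrans (esym (pb_sqE b))); congr (w n _).
      have /= -> := staysE st.
      by rewrite [LHS]surjective_pairing toward_away.
    exists H; split=> // n b.
    exact: (smap_congr
      (exist _ (b, dconst n (~~ e)) (or_intror (@stays_dconst _ n)) :
         ssub (box_sub (sub0 B) (~~ e)) n) H1).
  have [r [r1 r2]] := pb_map (etrans (comp_assoc w (toward e T) _) (esym H2)).
  apply: (@deformation_anodyne e B E r) => n b.
    apply: pb_eq; rewrite -smap_compE ?r1 ?r2 ?H1 //= toward_away.
    by rewrite -surjective_pairing.
  move=> c bc; change (box_sub P e n ((pb1 w p ∘ r) n (b, c))); rewrite r1.
  by case: bc => [[Pb|st]|st]; [left|right|right] => //;
    exact: (toward_stays (or_introl st)) || exact: (toward_stays (or_intror st)).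
pose bx n (x : ssub E n) : ssub (box_sub P e) n :=
  exist (box_sub P e n) (pb1 w p n (proj1_sig x)) (proj2_sig x).
(* The transpose of [u]: evaluate each section at the identity simplex. *)
have [k kP] : exists k : ssub E ~> R, forall n x,
    fam (u n (bx n x)) (did n) (pb2 w p n (proj1_sig x)) (k n x).
  apply: (@graph_map (ssub E) R (fun n x r =>
    fam (u n (bx n x)) (did n) (pb2 w p n (proj1_sig x)) r)).
  - move=> m n f x r /(fam_act (famP _) f); rewrite dcomp_idl => hr.
    have -> : bx m (act f x) = act f (bx n x) by exact: eq_exist.
    by rewrite sfun_nat; apply/fam_did.
  - move=> n [b Eb]; apply: (fam_ex (famP _)).
    rewrite act_id; apply: (etrans (esym (pb_sqE b))).
    exact: esym (smap_congr (bx n (exist _ b Eb)) uw).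
  - by move=> n x r r'; apply: (fam_uniq (famP _)).
have [|h [h1 h2]] := anE _ _ q Fq k (v ∘ pb2 w p).
  by apply: smap_eq => n x; have [_] := fam_over (famP _) (kP n x).
have [g [g1 g2]] := dprod_smap h2.
exists g; split=> //; apply: smap_eq => n [t Pt].
have wu : dprod_map n (u n (exist _ t Pt)) = w n t.
  exact: (smap_congr (exist _ t Pt : ssub (box_sub P e) n) uw).
apply: esym; apply: dprod_eq => [|m a z r] /=.
  by rewrite -[RHS](smap_congr t (esym g1)).
move=> ur; have [pz _] := fam_over (famP (u n (exist _ t Pt))) ur.
have [x [x1 x2]] : exists x : B m, pb1 w p m x = act a t /\ pb2 w p m x = z.
  by apply: pb_ex; rewrite pz wu sfun_nat.
rewrite -/(fam _) -fam_did -sfun_nat -x1 -x2.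
suff -> : r = h m x by exact: g2.
have Ex : E m x.
  by change (box_sub P e m (pb1 w p m x)); rewrite x1; apply: sub_act Pt.
have -> : h m x = k m (exist _ x Ex) by rewrite -h1.
apply: (fam_uniq (famP (u m (bx m (exist _ x Ex)))) _ (kP m (exist _ x Ex))).
have -> : bx m (exist _ x Ex) = act a (exist _ t Pt : ssub (box_sub P e) n).
  exact: eq_exist.
by rewrite sfun_nat [proj1_sig _]/= x2; apply/fam_did.
Qed.

End DependentProduct.

(** A map on the preimage of [P] is a section over [P] of the dependent product. As this product is
    in [efib e], the section extends to all of [W], and evaluation turns it back into a lift on
    [Z]. *)
Lemma preim_anodyne e (Z W : sSet) (p : Z ~> W) (P : sub W) :
  path_lifting (~~ e) p -> eanodyne e (sub_incl P) ->
  eanodyne e (sub_incl (preim_sub p P)).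
Proof.
move=> pl anP R Z' q Fq u v uv.
have [g [g1 g2]] : exists g : ssub P ~> dprod p q v,
    dprod_map p q v ∘ g = sub_incl P /\ forall n (x : pb (sub_incl P) p n)
      (y : ssub (preim_sub p P) n),
    pb2 _ _ n x = proj1_sig y -> fam (g n (pb1 _ _ n x)) (did n) (proj1_sig y) (u n y).
  have memP n (x : pb (sub_incl P) p n) : preim_sub p P n (pb2 _ _ n x).
    change (P n (p n (pb2 _ _ n x))); rewrite -pb_sqE.
    exact: (proj2_sig (pb1 _ _ n x)).
  have knat m n (f : dhom m n) x : u m (exist _ (pb2 _ _ m (act f x)) (memP m (act f x))) =
      act f (u n (exist _ (pb2 _ _ n x) (memP n x))).
    by rewrite -sfun_nat; congr (u m _); apply: eq_exist; rewrite sfun_nat.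
  pose k := @SMap (pb (sub_incl P) p) R _ knat.
  have [|g [g1 g2]] := @dprod_smap Z W R Z' p q v _ (sub_incl P) k.
    apply: smap_eq => n x.
    exact: (smap_congr (exist _ _ (memP n x) : ssub (preim_sub p P) n) uv).
  exists g; split=> // n x [z Pz] e1; have := g2 n x; rewrite -e1.
  by congr (fam _ _ _ _); congr (u n _); apply: eq_exist.
have [|h [h1 h2]] := anP _ _ _ (@dprod_efib e Z W R Z' p q v pl Fq) g (idm W).
  by rewrite comp_idl.
have [k kP] : exists k : Z ~> R, forall n z, fam (h n (p n z)) (did n) z (k n z).
  apply: (@graph_map Z R (fun n z r => fam (h n (p n z)) (did n) z r)).
  - move=> m n f z r /(fam_act (famP _) f); rewrite dcomp_idl !sfun_nat => hr.
    by apply/fam_did.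
  - move=> n z; apply: (fam_ex (famP _)); rewrite act_id.
    exact: esym (smap_congr (p n z) h2).
  - by move=> n z r r'; apply: (fam_uniq (famP _)).
exists k; split; apply: smap_eq => n z.
  apply: (fam_uniq (famP (h n (p n (proj1_sig z)))) (kP n (proj1_sig z))).
  have [x [x1 x2]] : exists x : pb (sub_incl P) p n,
      pb1 _ _ n x = exist _ (p n (proj1_sig z)) (proj2_sig z) /\ pb2 _ _ n x = proj1_sig z.
    exact: pb_ex.
  have := g2 n x z x2; rewrite x1 -h1; exact.
by have [] := fam_over (famP _) (kP n z).
Qed.

(** * Cylinders in slice model structures *)

Section ModelGeneralities.
Variables (C : category) (M : model_structure C).

(** Retract argument: lifting against the cofibration in a factorization of [f] makes [f] a retract
    of a trivial fibration. The next two lemmas argue in the same way. *)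
Lemma weq_of_rlp (X Y : C) (f : X ~> Y) :
  (forall (A B : C) (i : A ~> B), cof M i -> has_lifting i f) -> weq M f.
Proof.
move=> lp; have [Z [i [p [ci fp wp pi]]]] := cof_tfib_factor M f.
have [|h [hi fh]] := lp _ _ i ci (idm X) p; first by rewrite comp_idr pi.
apply: weq_retract wp; exists i, h, (idm Y), (idm Y).
by split; rewrite ?comp_idl.
Qed.

Lemma weq_of_llp (A B : C) (i : A ~> B) :
  (forall (X Y : C) (p : X ~> Y), fib M p -> has_lifting i p) -> weq M i.
Proof.
move=> lp; have [Z [j [p [cj wj fp pj]]]] := tcof_fib_factor M i.
have [|h [hi ph]] := lp _ _ p fp j (idm B); first by rewrite comp_idl pj.
apply: weq_retract wj; exists (idm A), (idm A), h, p.
by split; rewrite ?comp_idl ?comp_idr.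
Qed.

Lemma fib_of_rlp (X Y : C) (p : X ~> Y) :
  (forall (A B : C) (i : A ~> B), cof M i -> weq M i -> has_lifting i p) -> fib M p.
Proof.
move=> lp; have [Z [j [q [cj wj fq qj]]]] := tcof_fib_factor M p.
have [|h [hj ph]] := lp _ _ j cj wj (idm X) q; first by rewrite comp_idr qj.
apply: fib_retract fq; exists j, h, (idm Y), (idm Y).
by split; rewrite ?comp_idl.
Qed.

Lemma weq_idm (X : C) : weq M (idm X).
Proof.
apply: weq_of_llp => Y Z p _ u v e; exists u.
by split; rewrite ?comp_idr // e comp_idr.
Qed.

Lemma fibrant_ext (A B X : C) (i : A ~> B) (u : A ~> X) :
  fibrant M X -> cof M i -> weq M i -> exists h, h ∘ i = u.
Proof.
move=> [T [f [Tt ff]]] ci wi; have [t _] := Tt B.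
have [|h [hi _]] := tcof_fib_lifting ci wi ff (u := u) (v := t).
  by have [z zu] := Tt A; rewrite (zu (f ∘ u)) (zu (t ∘ i)).
by exists h.
Qed.

Lemma fibrant_fib (X Y : C) (f : X ~> Y) : fib M f -> fibrant M Y -> fibrant M X.
Proof.
move=> ff [T [g [Tt fg]]]; exists T, (g ∘ f); split=> //.
apply: fib_of_rlp => A B i ci wi.
by apply: has_lifting_comp; apply: (tcof_fib_lifting ci wi).
Qed.

End ModelGeneralities.

(** The nerve of the groupoid with two isomorphic objects. *)
Program Definition J : sSet :=
  @SSet (fun n => 'I_n.+1 -> bool) (fun _ _ f x => fun i => x (f i)) _ _.
Next Obligation. by move=> n x /=; apply/funext => i; rewrite dmkE. Qed.
Next Obligation. by move=> l m n g f x /=; apply/funext => i; rewrite dcompE. Qed.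

(** A simplex of [J] is an arbitrary labelling of its vertices, so it is enough to label the
    vertices of [B]; those outside the image of [i] receive [false]. *)
Lemma J_ext (A B : sSet) (i : A ~> B) (u : A ~> J) : injective_smap i ->
  exists h : B ~> J, h ∘ i = u.
Proof.
move=> inj_i.
pose phi (b : B 0) := `[< exists2 a : A 0, i 0 a = b & u 0 a ord0 >].
have hnat m n (f : dhom m n) b :
    (fun j => phi (act (dvertex j 0) (act f b))) =
    act f ((fun j => phi (act (dvertex j 0) b)) : J n).
  apply/funext => j /=; rewrite -act_comp; congr (phi (act _ b)).
  by apply: dhom_eq => l; rewrite dcompE !dmkE.
exists (@SMap B J _ hnat); apply: smap_eq => n a; apply/funext => j /=.
have uE : u n a j = u 0 (act (dvertex j 0) a) ord0 by rewrite sfun_nat /= dmkE.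
rewrite uE /phi -sfun_nat; apply/asboolP/idP; last by exists (act (dvertex j 0) a).
by move=> [a' /inj_i ->].
Qed.

Definition jstays (b : bool) n (j : 'I_n.+1 -> bool) : Prop := forall i, j i = b.

(** The union of [D x J] and [C x {false}]. *)
Program Definition cyl1_sub (D C : sSet) (g : D ~> C) : sub (sprod C J) :=
  @Sub (sprod C J) (fun n x => im_sub g n x.1 \/ jstays false x.2) _.
Next Obligation.
move=> D C g m n f [c j] /= [Dc|jc]; first by left; apply: (sub_act (s := im_sub g)).
by right => i; apply: jc.
Qed.

(** The union of [D x J] and both ends of [C x J]. *)
Program Definition cyl2_sub (D C : sSet) (g : D ~> C) : sub (sprod C J) :=
  @Sub (sprod C J) (fun n x => im_sub g n x.1 \/ exists b, jstays b x.2) _.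
Next Obligation.
move=> D C g m n f [c j] /= [Dc|[b jc]]; first by left; apply: (sub_act (s := im_sub g)).
by right; exists b => i; apply: jc.
Qed.

Definition jconst (X : sSet) (b : bool) : X ~> J :=
  @SMap X J (fun _ _ _ => b) (fun _ _ _ _ => erefl).

Section SliceModel.
Variables (S : sSet) (M : model_structure (slice S)).
Hypothesis cofE : forall (X Y : slice S) (f : X ~> Y), cof M f <-> is_mono f.

Lemma slice_mono (X Y : slice S) (f : X ~> Y) :
  is_mono f <-> injective_smap (slice_mor f).
Proof.
split=> [fm n x y fxy|fi Z g h gh].
  pose Z : slice S := SliceObj (slice_map X ∘ yo x).
  have ye : slice_map X ∘ yo y = slice_map X ∘ yo x.
    rewrite -(slice_morP f); apply: smap_eq => m a /=.
    by rewrite !sfun_nat /= fxy.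
  pose gx : Z ~> X := @SliceHom _ _ Z X (yo x) erefl.
  pose gy : Z ~> X := @SliceHom _ _ Z X (yo y) ye.
  have /fm e : f ∘ gx = f ∘ gy.
    by apply: slice_hom_eq; apply: smap_eq => m a /=; rewrite !sfun_nat fxy.
  have := smap_congr (did n : Simplex n n) (congr1 (@slice_mor _ _ _ _) e).
  by rewrite /= !act_id.
apply: slice_hom_eq; apply: smap_eq => n z; apply: fi.
exact: (smap_congr z (congr1 (@slice_mor _ _ _ _) gh)).
Qed.

Lemma cof_inj (X Y : slice S) (f : X ~> Y) : cof M f <-> injective_smap (slice_mor f).
Proof. by rewrite cofE slice_mono. Qed.

Lemma slice_is_lift (A B X Y : slice S) (i : A ~> B) (f : X ~> Y) (u : A ~> X)
    (v : B ~> Y) (h : slice_dom B ~> slice_dom X) :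
  is_lift (slice_mor i) (slice_mor f) (slice_mor u) (slice_mor v) h ->
  exists2 k, slice_mor k = h & is_lift i f u v k.
Proof.
move=> [h1 h2]; have hS : slice_map X ∘ h = slice_map B.
  by rewrite -(slice_morP f) -comp_assoc h2 slice_morP.
by exists (SliceHom hS) => //; split; apply: slice_hom_eq.
Qed.

Lemma slice_has_lifting (A B X Y : slice S) (i : A ~> B) (f : X ~> Y) :
  has_lifting (slice_mor i) (slice_mor f) -> has_lifting i f.
Proof.
move=> lp u v /(congr1 (@slice_mor _ _ _ _)) uv.
have [h hl] := lp _ _ uv.
by have [k _ kl] := slice_is_lift hl; exists k.
Qed.

Lemma has_lifting_slice (A B : sSet) (i : A ~> B) (X Y : slice S) (f : X ~> Y) :
  (forall t : B ~> S, has_lifting (slice_over t i) f) -> has_lifting i (slice_mor f).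
Proof.
move=> lp u v uv.
pose t := slice_map Y ∘ v.
have ut : slice_map X ∘ u = t ∘ i.
  by rewrite -(slice_morP f) -comp_assoc uv comp_assoc.
have [|h [h1 h2]] := lp t (@SliceHom _ _ (SliceObj (t ∘ i)) X u ut)
  (@SliceHom _ _ (SliceObj t) Y v erefl).
  exact: slice_hom_eq.
exists (slice_mor h); split.
  exact: (congr1 (@slice_mor _ _ _ _) h1).
exact: (congr1 (@slice_mor _ _ _ _) h2).
Qed.

Lemma tfib_has_lifting (X Y : slice S) (f : X ~> Y) : fib M f -> weq M f ->
  forall (A B : sSet) (i : A ~> B), injective_smap i -> has_lifting i (slice_mor f).
Proof.
move=> ff wf A B i inj_i; apply: has_lifting_slice => t.
by apply: (cof_tfib_lifting (m := M)) => //; apply/cof_inj.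
Qed.

Lemma weq_has_lifting (X Y : slice S) (f : X ~> Y) :
  (forall (A B : sSet) (i : A ~> B), injective_smap i -> has_lifting i (slice_mor f)) ->
  weq M f.
Proof.
move=> lp; apply: weq_of_rlp => A B i /cof_inj inj_i.
by apply: slice_has_lifting; apply: lp.
Qed.

Definition cyl (X : slice S) : slice S := SliceObj (slice_map X ∘ spr1 (slice_dom X) J).

Definition cyl_pr (X : slice S) : cyl X ~> X :=
  @SliceHom _ _ (cyl X) X (spr1 (slice_dom X) J) erefl.

Definition cyl_in (b : bool) (X : slice S) : X ~> cyl X.
refine (@SliceHom _ _ X (cyl X) (spair (idm (slice_dom X)) (jconst (slice_dom X) b)) _).
exact: smap_eq.
Defined.

Lemma cyl_prK b (X : slice S) : cyl_pr X ∘ cyl_in b X = idm X.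
Proof. by apply: slice_hom_eq; apply: smap_eq. Qed.

(** Since [J] has the extension property for monomorphisms, the projection lifts against all of
    them. *)
Lemma weq_cyl_pr X : weq M (cyl_pr X).
Proof.
apply: weq_has_lifting => A B i inj_i u v uv.
have [h2 h2i] := J_ext (spr2 _ _ ∘ u) inj_i.
exists (spair v h2); split; last exact: smap_eq.
apply: smap_eq => n a; apply: (etrans _ (esym (surjective_pairing _))).
congr pair; first exact: (esym (smap_congr a uv)).
exact: (smap_congr a h2i).
Qed.

Lemma weq_cyl_in b X : weq M (cyl_in b X).
Proof. by apply: weq_cancell (weq_cyl_pr X) _; rewrite cyl_prK; apply: weq_idm. Qed.

Lemma cof_cyl_in b X : cof M (cyl_in b X).
Proof. by apply/cof_inj => n x y [->]. Qed.

Definition cyl1 (D C : slice S) (g : D ~> C) : slice S :=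
  SliceObj (slice_map (cyl C) ∘ sub_incl (cyl1_sub (slice_mor g))).
Definition cyl1_in (D C : slice S) (g : D ~> C) : cyl1 g ~> cyl C :=
  @SliceHom _ _ (cyl1 g) (cyl C) (sub_incl (cyl1_sub (slice_mor g))) erefl.

Definition cyl2 (D C : slice S) (g : D ~> C) : slice S :=
  SliceObj (slice_map (cyl C) ∘ sub_incl (cyl2_sub (slice_mor g))).
Definition cyl2_in (D C : slice S) (g : D ~> C) : cyl2 g ~> cyl C :=
  @SliceHom _ _ (cyl2 g) (cyl C) (sub_incl (cyl2_sub (slice_mor g))) erefl.

Lemma cof_cyl1 (D C : slice S) (g : D ~> C) : cof M (cyl1_in g).
Proof. by apply/cof_inj; apply: sub_incl_inj. Qed.

Lemma cof_cyl2 (D C : slice S) (g : D ~> C) : cof M (cyl2_in g).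
Proof. by apply/cof_inj; apply: sub_incl_inj. Qed.

Lemma weq_cyl1 (D C : slice S) (g : D ~> C) : cof M g -> weq M (cyl1_in g).
Proof.
move=> cg; have inj_g := (cof_inj g).1 cg.
have knat m n (f : dhom m n) (c : slice_dom C n) :
   exist (cyl1_sub (slice_mor g) m) (act f c, fun=> false) (or_intror (fun=> erefl)) =
   act f (exist _ (c, fun=> false) (or_intror (fun=> erefl)) :
     ssub (cyl1_sub (slice_mor g)) n).
  exact: eq_exist.
pose k0 := @SMap (slice_dom C) (ssub (cyl1_sub (slice_mor g))) _ knat.
have k0S : slice_map (cyl1 g) ∘ k0 = slice_map C by apply: smap_eq.
pose k : C ~> cyl1 g := @SliceHom _ _ C (cyl1 g) k0 k0S.
have lnat m n (f : dhom m n) (x : sprod (slice_dom D) J n) :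
   exist (cyl1_sub (slice_mor g) m) (slice_mor g m (act f x).1, (act f x).2)
     (or_introl (ex_intro _ _ erefl)) =
   act f (exist _ (slice_mor g n x.1, x.2) (or_introl (ex_intro _ _ erefl)) :
     ssub (cyl1_sub (slice_mor g)) n).
  by apply: eq_exist; rewrite /= sfun_nat.
pose l0 := @SMap (sprod (slice_dom D) J) (ssub (cyl1_sub (slice_mor g))) _ lnat.
have l0S : slice_map (cyl1 g) ∘ l0 = slice_map (cyl D).
  by apply: smap_eq => n x /=; rewrite -[RHS](smap_congr x.1 (slice_morP g)).
pose l : cyl D ~> cyl1 g := @SliceHom _ _ (cyl D) (cyl1 g) l0 l0S.
(* [k] is the pushout along [g] of the trivial cofibration [cyl_in false D], hence lifts against
   fibrations. The claim follows by two-out-of-three. *)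
have wk : weq M k.
  apply: weq_of_llp => X Y f ff u v uv.
  have [|h [h1 h2]] := tcof_fib_lifting (cof_cyl_in false D) (weq_cyl_in false D) ff
     (u := u ∘ g) (v := v ∘ l).
    rewrite comp_assoc uv -!comp_assoc; congr (v ∘ _).
    by apply: slice_hom_eq; apply: smap_eq => n x; apply: eq_exist.
  pose G n (x : slice_dom (cyl1 g) n) y :=
    (exists2 d, x = l0 n d & y = slice_mor h n d) \/
    (exists2 c, x = k0 n c & y = slice_mor u n c).
  have common n d c : l0 n d = k0 n c -> slice_mor h n d = slice_mor u n c.
    case: d => d j /(congr1 sval) /= [<- ->].
    exact: (smap_congr d (congr1 (@slice_mor _ _ _ _) h1)).
  have [w wG] : exists w : slice_dom (cyl1 g) ~> slice_dom X, forall n x, G n x (w n x).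
    apply: (@graph_map (slice_dom (cyl1 g)) (slice_dom X) G).
    - move=> m n a x y [[d -> ->]|[c -> ->]]; [left; exists (act a d)|right; exists (act a c)];
        by rewrite sfun_nat.
    - move=> n [[c j] [[d /= cd]|jf]].
        exists (slice_mor h n (d, j)); left; exists (d, j) => //.
        by apply: eq_exist; rewrite /= cd.
      exists (slice_mor u n c); right; exists c => //.
      by apply: eq_exist; congr pair; apply/funext => i; apply: jf.
    - move=> n x y y' [[d xd ->]|[c xc ->]] [[d' xd' ->]|[c' xc' ->]].
      + move: xd'; rewrite xd => /(congr1 sval) /= [/inj_g e1 e2]; congr (slice_mor h n _).
        by rewrite (surjective_pairing d) e1 e2 -surjective_pairing.
      + by apply: common; rewrite -xd.
      + by apply: esym; apply: common; rewrite -xc.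
      + by move: xc'; rewrite xc => /(congr1 sval) /= [->].
  suff wl : is_lift (slice_mor k) (slice_mor f) (slice_mor u) (slice_mor v) w.
    by have [w' _ w'l] := slice_is_lift wl; exists w'.
  split; apply: smap_eq => n x.
    have [[d xd wd]|[c xc wc]] := wG n (k0 n x).
      by rewrite smap_compE [LHS]wd; apply: common.
    by rewrite smap_compE [LHS]wc; move: xc => /(congr1 sval) /= [->].
  rewrite smap_compE; have [[d -> ->]|[c -> ->]] := wG n x.
    exact: (smap_congr d (congr1 (@slice_mor _ _ _ _) h2)).
  exact: (smap_congr c (congr1 (@slice_mor _ _ _ _) uv)).
apply: weq_cancelr wk _.
suff -> : cyl1_in g ∘ k = cyl_in false C by apply: weq_cyl_in.
by apply: slice_hom_eq; apply: smap_eq.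
Qed.

Lemma weq_cyl2 (D C : slice S) (g : D ~> C) : cof M g -> weq M g -> weq M (cyl2_in g).
Proof.
move=> cg wg; have inj_g := (cof_inj g).1 cg.
have lnat m n (f : dhom m n) (x : sprod (slice_dom D) J n) :
   exist (cyl2_sub (slice_mor g) m) (slice_mor g m (act f x).1, (act f x).2)
     (or_introl (ex_intro _ _ erefl)) =
   act f (exist _ (slice_mor g n x.1, x.2) (or_introl (ex_intro _ _ erefl)) :
     ssub (cyl2_sub (slice_mor g)) n).
  by apply: eq_exist; rewrite /= sfun_nat.
pose l0 := @SMap (sprod (slice_dom D) J) (ssub (cyl2_sub (slice_mor g))) _ lnat.
have l0S : slice_map (cyl2 g) ∘ l0 = slice_map (cyl D).
  by apply: smap_eq => n x /=; rewrite -[RHS](smap_congr x.1 (slice_morP g)).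
pose l : cyl D ~> cyl2 g := @SliceHom _ _ (cyl D) (cyl2 g) l0 l0S.
have knat b m n (f : dhom m n) (c : slice_dom C n) :
   exist (cyl2_sub (slice_mor g) m) (act f c, fun=> b)
     (or_intror (ex_intro _ b (fun=> erefl))) =
   act f (exist _ (c, fun=> b) (or_intror (ex_intro _ b (fun=> erefl))) :
     ssub (cyl2_sub (slice_mor g)) n).
  exact: eq_exist.
pose k0 b := @SMap (slice_dom C) (ssub (cyl2_sub (slice_mor g))) _ (knat b).
have k0S b : slice_map (cyl2 g) ∘ k0 b = slice_map C by apply: smap_eq.
pose k b : C ~> cyl2 g := @SliceHom _ _ C (cyl2 g) (k0 b) (k0S b).
(* [l] attaches a copy of [C] along [g] at either end of [D x J], so it lifts against fibrations
   because [g] does. *)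
have wl : weq M l.
  apply: weq_of_llp => X Y f ff u v uv.
  have ex b : exists h : C ~> X, h ∘ g = u ∘ cyl_in b D /\ f ∘ h = v ∘ k b.
    apply: (tcof_fib_lifting cg wg ff).
    rewrite comp_assoc uv -!comp_assoc; congr (v ∘ _).
    by apply: slice_hom_eq; apply: smap_eq => n x; apply: eq_exist.
  have [h hP] := choice ex.
  pose G n (x : slice_dom (cyl2 g) n) y :=
    (exists2 d, x = l0 n d & y = slice_mor u n d) \/
    (exists b, exists2 c, x = k0 b n c & y = slice_mor (h b) n c).
  have common n d b c : l0 n d = k0 b n c -> slice_mor u n d = slice_mor (h b) n c.
    case: d => d j /(congr1 sval) /= [<- ->]; apply: esym.
    exact: (smap_congr d (congr1 (@slice_mor _ _ _ _) (hP b).1)).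
  have [w wG] : exists w : slice_dom (cyl2 g) ~> slice_dom X, forall n x, G n x (w n x).
    apply: (@graph_map (slice_dom (cyl2 g)) (slice_dom X) G).
    - move=> m n a x y [[d -> ->]|[b [c -> ->]]];
        [left; exists (act a d)|right; exists b; exists (act a c)]; by rewrite sfun_nat.
    - move=> n [[c j] [[d /= cd]|[b jb]]].
        exists (slice_mor u n (d, j)); left; exists (d, j) => //.
        by apply: eq_exist; rewrite /= cd.
      exists (slice_mor (h b) n c); right; exists b; exists c => //.
      by apply: eq_exist; congr pair; apply/funext => i; apply: jb.
    - move=> n x y y' [[d xd ->]|[b [c xc ->]]] [[d' xd' ->]|[b' [c' xc' ->]]].
      + move: xd'; rewrite xd => /(congr1 sval) /= [/inj_g e1 e2]; congr (slice_mor u n _).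
        by rewrite (surjective_pairing d) e1 e2 -surjective_pairing.
      + by apply: common; rewrite -xd.
      + by apply: esym; apply: common; rewrite -xc.
      + move: xc'; rewrite xc => /(congr1 sval) /= [-> /(congr1 (fun F => F ord0)) e].
        by rewrite e.
  suff wl : is_lift (slice_mor l) (slice_mor f) (slice_mor u) (slice_mor v) w.
    by have [w' _ w'l] := slice_is_lift wl; exists w'.
  split; apply: smap_eq => n x.
    have [[d xd wd]|[b [c xc wc]]] := wG n (l0 n x).
      rewrite smap_compE [LHS]wd; congr (slice_mor u n _).
      move: xd => /(congr1 sval) /= [/inj_g e1 e2].
      by rewrite (surjective_pairing d) -e1 -e2 -surjective_pairing.
    by rewrite smap_compE [LHS]wc; apply: esym; apply: common.
  rewrite smap_compE; have [[d -> ->]|[b [c -> ->]]] := wG n x.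
    exact: (smap_congr d (congr1 (@slice_mor _ _ _ _) uv)).
  exact: (smap_congr c (congr1 (@slice_mor _ _ _ _) (hP b).2)).
apply: weq_cancelr wl _.
have gE : cyl_pr C ∘ (cyl2_in g ∘ l) = g ∘ cyl_pr D.
  by apply: slice_hom_eq; apply: smap_eq.
apply: weq_cancell (weq_cyl_pr C) _; rewrite gE.
exact: weq_comp (weq_cyl_pr D) wg.
Qed.

End SliceModel.

(** * Proper and smooth maps *)

Lemma slice_congr (S : sSet) (X Y : slice S) (f g : X ~> Y) n (x : slice_dom X n) :
  f = g -> slice_mor f n x = slice_mor g n x.
Proof. by move->. Qed.

(** Relabelling by [false] the vertices at time [e] is simplicial, as [J] allows any labelling; it
    deforms [C x J] onto [C x {false}] for either value of [e]. *)
Lemma cyl1_anodyne e (D C : sSet) (g : D ~> C) : eanodyne e (sub_incl (cyl1_sub g)).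
Proof.
have rnat m n (f : dhom m n) (x : sprod (sprod C J) D1 n) :
   ((act f x).1.1, fun i => if dfun (act f x).2 i == e :> nat then false else (act f x).1.2 i) =
   act f ((x.1.1, fun i => if dfun x.2 i == e :> nat then false else x.1.2 i) : sprod C J n).
  by congr pair; apply/funext => i; rewrite /= dcompE.
apply: (@deformation_anodyne e _ (cyl1_sub g) (@SMap (sprod (sprod C J) D1) (sprod C J) _ rnat)).
  move=> n [c j] /=; congr pair; apply/funext => i; rewrite dconstE.
  by case: (e).
move=> n [c j] t [[Dc|js]|st] /=; first by left.
  by right => i /=; case: eqP => // _; apply: js.
by right => i /=; rewrite st eqxx.
Qed.

(** Exchanging the factors [Delta^1] and [J] turns this inclusion into the box on [P x J] together
    with the two ends of [T x J]. *)
Lemma box_cyl2_anodyne e (T : sSet) (P : sub T) :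
  eanodyne e (sub_incl (cyl2_sub (box P e))).
Proof.
pose P2 := @Sub (sprod T J) (fun n x => P n x.1 \/ exists b, jstays b x.2)
  (fun m n f x Px => match Px with
     | or_introl h => or_introl (sub_act f h)
     | or_intror (ex_intro b h) => or_intror (ex_intro _ b (fun i => h (f i)))
   end).
apply: eanodyne_retract (@box_anodyne e _ P2).
apply: (@sub_retract _ _ (cyl2_sub (box P e)) (box_sub P2 e)
  (@SMap (sprod (sprod T D1) J) (sprod (sprod T J) D1)
     (fun n x => ((x.1.1, x.2), x.1.2)) (fun _ _ _ _ => erefl))
  (@SMap (sprod (sprod T J) D1) (sprod (sprod T D1) J)
     (fun n x => ((x.1.1, x.2), x.1.2)) (fun _ _ _ _ => erefl))).
- by apply: smap_eq => n [[t c] j].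
- move=> n [[t c] j] [[[x xP] /= xE]|jb]; last by left; right.
  by rewrite -{}xE in xP; case: xP => [Pt|st]; [left; left|right].
- move=> n [[t j] c] [[Pt|jb]|st]; [left|by right|left].
    by exists (exist (box_sub P e n) (t, c) (or_introl Pt)).
  by exists (exist (box_sub P e n) (t, c) (or_intror st)).
Qed.

(** * Homotopies relative to a subobject *)

Section Homotopy.
Variables (S : sSet) (C D X : slice S) (g : D ~> C) (f0 f1 : C ~> X).
Hypothesis f01 : f0 ∘ g = f1 ∘ g.

(** [m] glues [f0], [f1] and the constant homotopy on [D]. An extension of [m] to the cylinder is
    thus a homotopy relative to [D], and over [Y] when [f0] and [f1] agree there. *)
Lemma homotopy_rel : exists m : cyl2 g ~> X,
  (forall H : cyl C ~> X, H ∘ cyl2_in g = m ->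
    [/\ H ∘ cyl1_in g = f0 ∘ cyl_pr C ∘ cyl1_in g,
        H ∘ cyl_in false C = f0 & H ∘ cyl_in true C = f1]) /\
  (forall (Y : slice S) (p : X ~> Y), p ∘ f0 = p ∘ f1 ->
    p ∘ m = p ∘ f0 ∘ cyl_pr C ∘ cyl2_in g).
Proof.
have eqD n c : im_sub (slice_mor g) n c -> slice_mor f1 n c = slice_mor f0 n c.
  by move=> [d ->]; exact: esym (slice_congr d f01).
have mnat m n (a : dhom m n) (x : slice_dom (cyl2 g) n) :
    (if (sval (act a x)).2 ord0 then slice_mor f1 m (sval (act a x)).1
     else slice_mor f0 m (sval (act a x)).1) =
    act a (if (sval x).2 ord0 then slice_mor f1 n (sval x).1
           else slice_mor f0 n (sval x).1).
  rewrite (fun_if (act a)) -!sfun_nat; case: x => [[c j] [Dc|[b jb]]] /=.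
    rewrite eqD; last exact: (sub_act (s := im_sub (slice_mor g))).
    by do 2 case: ifP.
  by rewrite (jb (a ord0) : j (a ord0) = b) (jb ord0 : j ord0 = b).
pose m0 := @SMap (slice_dom (cyl2 g)) (slice_dom X) _ mnat.
have m0S : slice_map X ∘ m0 = slice_map (cyl2 g).
  apply: smap_eq => n [[c j] h] /=.
  by case: (j ord0); [rewrite -[RHS](smap_congr c (slice_morP f1))|
    rewrite -[RHS](smap_congr c (slice_morP f0))].
exists (SliceHom m0S); split=> [H Hm|Y p pf]; last first.
  apply: slice_hom_eq; apply: smap_eq => n [[c j] h] /=.
  by case: (j ord0) => //; exact: (esym (slice_congr c pf)).
have HE n (x : sprod (slice_dom C) J n) (hx : cyl2_sub (slice_mor g) n x) :
    slice_mor H n x = if x.2 ord0 then slice_mor f1 n x.1 else slice_mor f0 n x.1.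
  exact: (slice_congr (exist _ x hx : slice_dom (cyl2 g) n) Hm).
split; apply: slice_hom_eq; apply: smap_eq => n x.
- case: x => [[c j] h] /=; rewrite HE /=.
    case: h => [Dc|/= -> //]; by rewrite (eqD _ _ Dc) if_same.
  by case: h => [Dc|jf]; [left|right; exists false].
- by rewrite /= HE //=; right; exists false.
- by rewrite /= HE //=; right; exists true.
Qed.

End Homotopy.

Definition econtravariant (e : bool) (S : sSet) (M : model_structure (slice S)) : Prop :=
  (forall (X Y : slice S) (f : X ~> Y), cof M f <-> is_mono f) /\
  (forall X : slice S, fibrant M X <-> efib e (slice_map X)).

(** * Anodyne maps and trivial cofibrations *)

Section Anodyne.
Variables (e : bool) (S : sSet) (M : model_structure (slice S)).
Hypothesis contraM : econtravariant e M.
Let cofE := contraM.1.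
Let fibrantE := contraM.2.
Let injE := cof_inj cofE.

Definition slice_top : slice S := SliceObj (idm S).

Lemma slice_top_terminal : is_terminal slice_top.
Proof.
move=> X; exists (@SliceHom _ _ X slice_top (slice_map X) (comp_idl _)) => g.
by apply: slice_hom_eq; rewrite /= -(slice_morP g) comp_idl.
Qed.

Lemma fibrant_top : fibrant M slice_top.
Proof.
apply/fibrantE => T P u v uv; exists v; split; last exact: comp_idl.
by rewrite -uv; exact: comp_idl.
Qed.

Lemma anodyne_ext (A B X : slice S) (i : A ~> B) (u : A ~> X) :
  eanodyne e (slice_mor i) -> fibrant M X -> exists h, h ∘ i = u.
Proof.
move=> an /fibrantE fX.
have [|h [h1 h2]] := an _ _ _ fX (slice_mor u) (slice_map B).
  by rewrite (slice_morP u) (slice_morP i).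
by exists (SliceHom h2); apply: slice_hom_eq.
Qed.

(** Factor a fibrant replacement of [g] as a trivial cofibration followed by a
    fibration [f]: the extension properties make [f] a homotopy equivalence. *)
Lemma weq_of_anodyne_cyl2 (D C : slice S) (g : D ~> C) : cof M g ->
    eanodyne e (slice_mor g) -> eanodyne e (sub_incl (cyl2_sub (slice_mor g))) ->
  weq M g.
Proof.
move=> cg an1 an2.
have [t _] := slice_top_terminal C.
have [C' [r [r' [cr wr fr' _]]]] := tcof_fib_factor M t.
have fC' : fibrant M C' by apply: fibrant_fib fr' fibrant_top.
have [W [j [f [cj wj ff fj]]]] := tcof_fib_factor M (r ∘ g).
have fW : fibrant M W by apply: fibrant_fib ff fC'.
have [h hg] := anodyne_ext j an1 fW.
have [|m [mH _]] := @homotopy_rel S C D C' g (f ∘ h) r.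
  by rewrite -comp_assoc hg.
have [H Hm] := @anodyne_ext _ _ _ (cyl2_in g) m an2 fC'.
have {m mH Hm} [H1 _ Htrue] := mH H Hm.
(* Lifting the homotopy from [f ∘ h] to [r] along [f] replaces [h] by [h'] with [f ∘ h' = r]
   exactly; extending [h'] along [r] then yields a section [s] of [f]. *)
have [|K [K1 K2]] := tcof_fib_lifting (cof_cyl1 cofE g) (weq_cyl1 cofE cg) ff
  (u := h ∘ cyl_pr C ∘ cyl1_in g) (v := H).
  by rewrite H1 !comp_assoc.
pose h' := K ∘ cyl_in true C.
have fh' : f ∘ h' = r by rewrite comp_assoc K2.
have h'g : h' ∘ g = j.
  rewrite -hg; apply: slice_hom_eq; apply: smap_eq => n d.
  exact: (slice_congr (exist _ (slice_mor g n d, fun=> true)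
    (or_introl (ex_intro _ d erefl)) : slice_dom (cyl1 g) n) K1).
have [|s [sr fs]] := tcof_fib_lifting cr wr ff (u := h') (v := idm C').
  by rewrite comp_idl.
have [|m [mH mY]] := @homotopy_rel S W _ W j (s ∘ f) (idm W).
  by rewrite comp_idl -comp_assoc fj comp_assoc sr.
have fsf : f ∘ (s ∘ f) = f ∘ idm W by rewrite comp_assoc fs comp_idl comp_idr.
(* [L] is a homotopy over [C'] from [s ∘ f] to the identity of [W]. *)
have [|L [L1 L2]] := tcof_fib_lifting (cof_cyl2 cofE j) (weq_cyl2 cofE cj wj) ff
  (u := m) (v := f ∘ (s ∘ f) ∘ cyl_pr W).
  exact: mY.
have [_ Lfalse Ltrue] := mH L L1.
have wL : weq M L.
  by apply: weq_cancelr (weq_cyl_in cofE true W) _; rewrite Ltrue; apply: weq_idm.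
have wsf : weq M (s ∘ f).
  by rewrite -Lfalse; apply: weq_comp (weq_cyl_in cofE false W) wL.
(* Since [s] is a section of [f], the map [f] is a retract of [s ∘ f]. *)
have wf : weq M f.
  apply: weq_retract wsf; exists (idm W), (idm W), s, f.
  by split; rewrite ?comp_idl ?comp_idr // fsf comp_idr.
by apply: weq_cancell wr _; rewrite -fj; apply: weq_comp wj wf.
Qed.

Lemma fib_efib (X Y : slice S) (f : X ~> Y) : fib M f -> efib e (slice_mor f).
Proof.
move=> ff T P; apply: has_lifting_slice => t.
have cb : cof M (slice_over t (box P e)) by apply/injE; apply: sub_incl_inj.
apply: (tcof_fib_lifting cb) => //; apply: weq_of_anodyne_cyl2 => //.
  exact: box_anodyne.
exact: box_cyl2_anodyne.
Qed.

Lemma anodyne_weq (A B : slice S) (i : A ~> B) : eanodyne e (slice_mor i) -> weq M i.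
Proof.
move=> an; apply: weq_of_llp => X Y f /fib_efib Ff.
by apply: slice_has_lifting; apply: an.
Qed.

(** The problem is pulled back to one over [W], where [Rs] is fibrant over [S]. The partial section
    extends to [g], which is a section only up to a homotopy relative to [A]. *)
Lemma tcof_anodyne (A W : slice S) (j : A ~> W) : cof M j -> weq M j ->
  fibrant M W -> eanodyne e (slice_mor j).
Proof.
move=> cj wj fW R Z q Fq u v quv.
pose Rs : slice S := SliceObj (slice_map W ∘ pb2 q v).
have F2 : efib e (pb2 q v).
  by move=> T P; apply: has_lifting_pullback (pb_pullback q v) (Fq T P).
have fR : fibrant M Rs.
  by apply/fibrantE => T P; apply: has_lifting_comp (F2 T P) _; exact: ((fibrantE W).1 fW T P).
have [s0 [s1 s2]] := pb_map quv.
have sS : slice_map Rs ∘ s0 = slice_map A by rewrite -comp_assoc s2 slice_morP.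
pose s : A ~> Rs := SliceHom sS.
pose pi : Rs ~> W := @SliceHom _ _ Rs W (pb2 q v) erefl.
have [g gj] := fibrant_ext s fR cj wj.
have [|m [mH _]] := @homotopy_rel S W A W j (pi ∘ g) (idm W).
  by rewrite comp_idl -comp_assoc gj; apply: slice_hom_eq.
have [H /mH [H1 _ Htrue]] := fibrant_ext m fW (cof_cyl2 cofE j) (weq_cyl2 cofE cj wj).
(* Lifting the homotopy along [pb2 q v], starting at [g] and constant over [A], yields at its end
   [true] a strict section. *)
have [|K [K1 K2]] := @cyl1_anodyne e _ _ (slice_mor j) _ _ _ F2
  (slice_mor (g ∘ cyl_pr W ∘ cyl1_in j)) (slice_mor H).
  by apply: smap_eq => n x; exact: esym (slice_congr (x : slice_dom (cyl1 j) n) H1).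
exists (pb1 q v ∘ K ∘ slice_mor (cyl_in true W)); split.
  apply: smap_eq => n a; rewrite -s1.
  have Ka := smap_congr (exist _ (slice_mor j n a, fun=> true)
    (or_introl (ex_intro _ a erefl)) : slice_dom (cyl1 j) n) K1.
  congr (pb1 q v n _); apply: (etrans Ka).
  exact: (slice_congr a gj).
apply: smap_eq => n x; pose xt : sprod (slice_dom W) J n := (x, fun=> true).
apply: (etrans (pb_sqE (K n xt))); congr (v n _).
by apply: (etrans (smap_congr xt K2)); exact: (slice_congr x Htrue).
Qed.

End Anodyne.

(** * Final maps and their base change *)

Definition efinal (e : bool) (X Y : sSet) (f : X ~> Y) : Prop :=
  forall (A : sSet) (q : Y ~> A), exists M : model_structure (slice A),
    econtravariant e M /\ weq M (slice_over q f).

(** Working over [B] itself makes the target the terminal object, so the middle term of the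
    factorization is fibrant and its trivial cofibration is anodyne. *)
Lemma efinal_factor e (A B : sSet) (v : A ~> B) : efinal e v ->
  exists (W : sSet) (j : A ~> W) (t : W ~> B),
    [/\ injective_smap j, eanodyne e j, t ∘ j = v &
        forall (K L : sSet) (i : K ~> L), injective_smap i -> has_lifting i t].
Proof.
move=> fv; have [M [cM wv]] := fv B (idm B).
have [W [j [t [cj wj ft tj]]]] := tcof_fib_factor M (slice_over (idm B) v).
have wt : weq M t by apply: weq_cancelr wj _; rewrite tj.
exists (slice_dom W), (slice_mor j), (slice_mor t); split.
- exact: (cof_inj cM.1 j).1 cj.
- apply: (tcof_anodyne cM cj wj); apply: fibrant_fib ft _.
  exact: (fibrant_top cM).
- by have := congr1 (@slice_mor _ _ _ _) tj.
- exact: tfib_has_lifting cM.1 _ _ _ ft wt.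
Qed.

Section EmptyBase.
Variables (e : bool) (S : sSet).
Hypothesis S0 : S 0 -> False.

Lemma empty_over (X : sSet) (f : X ~> S) n : X n -> False.
Proof. by move=> x; apply: S0; exact: (act (dvertex ord0 0) (f n x)). Qed.

Lemma empty_map (X Y : sSet) (f : X ~> S) : exists h : X ~> Y, True.
Proof.
have nat m n (a : dhom m n) (x : X n) :
   False_rect (Y m) (empty_over f (act a x)) = act a (False_rect (Y n) (empty_over f x)).
  by case: (empty_over f x).
by exists (@SMap X Y _ nat).
Qed.

Lemma empty_hom_eq (X Y : slice S) (f g : X ~> Y) : f = g.
Proof.
by apply: slice_hom_eq; apply: smap_eq => n x; case: (empty_over (slice_map X) x).
Qed.

Lemma empty_lifting (A B X Y : slice S) (i : A ~> B) (p : X ~> Y) : has_lifting i p.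
Proof.
move=> u v _; have [h _] := @empty_map (slice_dom B) (slice_dom X) (slice_map B).
have hS : slice_map X ∘ h = slice_map B.
  by apply: smap_eq => n x; case: (empty_over (slice_map B) x).
by exists (SliceHom hS); split; apply: empty_hom_eq.
Qed.

(** Over an empty base every object is empty and every lifting problem is solvable, so all three
    classes may contain all maps. This base is treated apart because a nonempty [B] has no map to
    it. *)
Program Definition empty_model : model_structure (slice S) :=
  @ModelStructure (slice S) (fun _ _ _ => True) (fun _ _ _ => True) (fun _ _ _ => True)
   _ _ _ _ _ _ _ _ _ _.
Next Obligation. by []. Qed.
Next Obligation. by []. Qed.
Next Obligation. by []. Qed.
Next Obligation. by []. Qed.
Next Obligation. by []. Qed.
Next Obligation. by []. Qed.
Next Obligation. by move=> *; apply: empty_lifting. Qed.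
Next Obligation. by move=> *; apply: empty_lifting. Qed.
Next Obligation. by move=> X Y f; exists Y, f, (idm Y); split=> //; apply: empty_hom_eq. Qed.
Next Obligation. by move=> X Y f; exists Y, f, (idm Y); split=> //; apply: empty_hom_eq. Qed.

Lemma empty_model_contravariant : econtravariant e empty_model.
Proof.
split=> [X Y f|X]; split=> // _.
- by move=> Z g h _; apply: empty_hom_eq.
- move=> T P u v uv; have [h _] := @empty_map _ (slice_dom X) v.
  exists h; split; apply: smap_eq => n x; first by case: (empty_over (v ∘ box P e) x).
  by case: (empty_over v x).
- have [t _] := slice_top_terminal X.
  by exists (slice_top S), t; split=> //; apply: slice_top_terminal.
Qed.
End EmptyBase.

(** With [v = t ∘ j], the square over [v] splits: [pb1 b t] is the base change of [t], and [k] is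
    that of [j]. *)
Lemma path_lifting_proper e (X Y : sSet) (p : X ~> Y) : path_lifting (~~ e) p ->
  forall (A B A' B' : sSet) (v : A ~> B) (c : B ~> Y) (w : A' ~> B')
    (b' : B' ~> X) (a : A' ~> A) (b : B' ~> B),
  is_pullback w a b v -> is_pullback b' b p c -> efinal e v -> efinal e w.
Proof.
move=> pl A B A' B' v c w b' a b pbA pbB fv S q.
have [Sempty|nS] := pselect (S 0 -> False).
  exists (empty_model Sempty); split=> //; exact: empty_model_contravariant.
have [s0 _] : exists s0 : S 0, True.
  by apply: contrapT => no; apply: nS => s0; apply: no; exists s0.
have qnat m n (f : dhom m n) (x : B n) :
    act (dvertex ord0 m) s0 = act f (act (dvertex ord0 n) s0).
  by rewrite -act_comp; congr (act _ s0); apply: to0_eq.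
(* The constant map at [s0] serves only to obtain the model structure over [S]. *)
have [M [cM _]] := fv S (@SMap B S (fun n _ => act (dvertex ord0 n) s0) qnat).
exists M; split=> //; have cofE := cM.1.
have [W [j [t [inj_j an_j tj lt]]]] := efinal_factor fv.
have [k [k1 k2]] : exists k : A' ~> pb b t, pb1 b t ∘ k = w /\ pb2 b t ∘ k = j ∘ a.
  by apply: pb_map; rewrite comp_assoc tj pbA.1.
have kS : q ∘ pb1 b t ∘ k = q ∘ w by rewrite -comp_assoc k1.
pose ks : (SliceObj (q ∘ w) : slice S) ~> (SliceObj (q ∘ pb1 b t) : slice S) :=
  @SliceHom _ _ (SliceObj (q ∘ w)) (SliceObj (q ∘ pb1 b t)) k kS.
have -> : slice_over q w = slice_over q (pb1 b t) ∘ ks.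
  by apply: slice_hom_eq; rewrite /= -k1.
apply: weq_comp; last first.
  apply: weq_has_lifting => // K L i inj_i.
  apply: has_lifting_pullback (is_pullback_sym (pb_pullback b t)) _; exact: lt.
apply: anodyne_weq cM _ _ _ _; rewrite -[slice_mor ks]/k.
have inj_k : injective_smap k.
  move=> n x y kxy; apply: (pullback_inj pbA).
    by rewrite -k1 !smap_compE kxy.
  by apply: inj_j; rewrite -!(smap_compE j a) -k2 !smap_compE kxy.
have pl2 : path_lifting (~~ e) (pb2 b t).
  move=> T; apply: has_lifting_pullback (pb_pullback b t) _.
  exact: has_lifting_pullback pbB (pl T).
(* Up to isomorphism, [k] is the inclusion of the preimage under [pb2 b t] of the image of [j], and
   [pb2 b t] is a base change of [p]. *)
apply: eanodyne_retract (im_retract inj_k).1 _.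
apply: (eanodyne_retract _ (preim_anodyne pl2 (eanodyne_retract (im_retract inj_j).2 an_j))).
apply: (@sub_retract _ _ _ _ (idm _) (idm _)).
- exact: comp_idl.
- by move=> n z [x ->]; exists (a n x); rewrite -(smap_compE j a) -k2.
- move=> n z [x /= zx].
  have [|y [y1 y2]] := pullback_cell pbA (x := pb1 b t n z) (z := x).
    by rewrite pb_sqE -tj; congr (t n _).
  exists y; apply: pb_eq; rewrite -smap_compE ?k1 ?k2 //.
  by rewrite smap_compE y2.
Qed.

Lemma final_efinal (X Y : sSet) (f : X ~> Y) : final f <-> efinal true f.
Proof.
split=> ff A q; have [M [[cM fM] wM]] := ff A q; exists M; split=> //; split=> // Z.
  by rewrite fM right_fibrationE.
by rewrite fM right_fibrationE.
Qed.

Lemma initial_efinal (X Y : sSet) (f : X ~> Y) : initial f <-> efinal false f.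
Proof.
split=> ff A q; have [M [[cM fM] wM]] := ff A q; exists M; split=> //; split=> // Z.
  by rewrite fM left_fibrationE.
by rewrite fM left_fibrationE.
Qed.

Theorem corollary4p46 :
  (forall (X Y : sSet) (p : X ~> Y), cocartesian_fibration p -> proper p) /\
  (forall (X Y : sSet) (p : X ~> Y), cartesian_fibration p -> smooth p).
Proof.
split=> X Y p pl A B A' B' v c w b' a b pbA pbB.
  rewrite !final_efinal; apply: path_lifting_proper pbA pbB => /=.
  exact: cocartesian_path_lifting.
rewrite !initial_efinal; apply: path_lifting_proper pbA pbB => /=.
exact: cartesian_path_lifting.
Qed.
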